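(* Let $K$ be a field. For any integers $\ell,r,c$ with $2\le\ell\le r\le c$, there exists a connected finite simple graph $G$ with $\ell(G)=\ell$, $\operatorname{reg}(S/J_G)=r$ and $c(G)=c$.
   Context: For a graph $G$ on vertex set $[n]$, $S=K[x_1,\dots,x_n,y_1,\dots,y_n]$ and $J_G\subseteq S$ is the binomial edge ideal of $G$, generated by $x_iy_j-x_jy_i$ for all edges $\{i,j\}$ of $G$ with $i<j$; $\operatorname{reg}$ is Castelnuovo–Mumford regularity. For a connected graph $G$, $\ell(G)$ is the length (number of edges) of a longest induced path in $G$, and $c(G)$ is the number of maximal cliques of $G$. *)

(* Defs.v *)
From HB Require Import structures.
From mathcomp Require Import all_boot all_order all_algebra.
From mathcomp Require Import mpoly.
Set Implicit Arguments. Unset Strict Implicit. Unset Printing Implicit Defensive.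
Import Order.TTheory GRing.Theory.
Local Open Scope ring_scope.

Definition simple_graph (n : nat) (G : rel 'I_n) : Prop :=
  ssrbool.symmetric G /\ ssrbool.irreflexive G.

Definition connected_graph (n : nat) (G : rel 'I_n) : Prop :=
  (0 < n)%N /\ forall x y : 'I_n, connect G x y.

(* s = [:: v_0; ...; v_k] is an induced path of G: the v_i are distinct,
   v_i and v_j are adjacent iff |i - j| = 1.  Its length is k = size s - 1. *)
Definition induced_path (n : nat) (G : rel 'I_n) (s : seq 'I_n) : Prop :=
  (0 < size s)%N /\ uniq s /\
  forall (x0 : 'I_n) (i j : nat), (i < size s)%N -> (j < size s)%N ->
    G (nth x0 s i) (nth x0 s j) = (i.+1 == j) || (j.+1 == i).

Definition longest_induced_path_length (n : nat) (G : rel 'I_n) (l : nat) : Prop :=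
  (exists s, induced_path G s /\ size s = l.+1) /\
  (forall s, induced_path G s -> (size s <= l.+1)%N).

Definition is_clique (n : nat) (G : rel 'I_n) (C : {set 'I_n}) : bool :=
  [forall x in C, forall y in C, (x != y) ==> G x y].

Definition is_maximal_clique (n : nat) (G : rel 'I_n) (C : {set 'I_n}) : bool :=
  is_clique G C &&
  [forall D : {set 'I_n}, (is_clique G D && (C \subset D)) ==> (D == C)].

Definition num_max_cliques (n : nat) (G : rel 'I_n) : nat :=
  #|[set C : {set 'I_n} | is_maximal_clique G C]|.

(* S = K[x_1..x_n, y_1..y_n] is {mpoly K[n + n]}; x_i = 'X_(lshift n i),
   y_i = 'X_(rshift n i). *)
Definition xv (K : fieldType) (n : nat) (i : 'I_n) : {mpoly K[n + n]} :=
  'X_(lshift n i).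
Definition yv (K : fieldType) (n : nat) (i : 'I_n) : {mpoly K[n + n]} :=
  'X_(rshift n i).

Definition binomial_edge_gens (K : fieldType) (n : nat) (G : rel 'I_n)
  : seq {mpoly K[n + n]} :=
  [seq xv K p.1 * yv K p.2 - xv K p.2 * yv K p.1
  | p <- enum [pred p : 'I_n * 'I_n | G p.1 p.2 && (p.1 < p.2)%N]].

Definition in_ideal (R : comNzRingType) (gs : seq R) (f : R) : Prop :=
  exists c : seq R, f = \sum_(i < size gs) c`_i * gs`_i.

Definition homog_of (K : fieldType) (m : nat) (d : nat) (p : {mpoly K[m]}) : bool :=
  all [pred mm | mdeg mm == d] (msupp p).

Definition res_rank (b : nat -> nat) (i : nat) : nat :=
  if i is 0 then 1%N else b i.

(* A minimal graded free resolution of S/I, where I is generated by gs: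
     0 -> F_p -> ... -> F_1 -> F_0 = S -> S/I -> 0,
   F_i = (+)_j S(-a i j) (j < rank of F_i), the map F_{i+1} -> F_i is
   v |-> v *m d i on row vectors, entry (j,k) of d i homogeneous of degree
   a (i+1) j - a i k; minimality: all nonzero entries have positive degree
   (i.e. lie in the graded maximal ideal). *)
Definition min_graded_free_res (K : fieldType) (m : nat) (gs : seq {mpoly K[m]})
  (p : nat) (b : nat -> nat)
  (a : forall i : nat, 'I_(res_rank b i) -> nat)
  (d : forall i : nat, 'M[{mpoly K[m]}]_(res_rank b i.+1, res_rank b i)) : Prop :=
  [/\
      (forall j, a 0%N j = 0%N),
      (forall i, (p < i)%N -> b i = 0%N),
      (forall i j k, d i j k = 0 \/
          ((a i k < a i.+1 j)%N /\ homog_of (a i.+1 j - a i k) (d i j k)))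
   & (
      (forall f, in_ideal gs f <->
          exists v : 'rV_(res_rank b 1), (v *m d 0%N) 0 0 = f) /\
      (forall i, d i.+1 *m d i = 0)
    /\ (* exactness at F_i, i >= 1 (also gives injectivity of F_p -> F_(p-1)) *)
      (forall i (v : 'rV_(res_rank b i.+1)), v *m d i = 0 ->
          exists w : 'rV_(res_rank b i.+2), v = w *m d i.+1))].

Definition res_reg (b : nat -> nat) (p : nat)
  (a : forall i : nat, 'I_(res_rank b i) -> nat) : nat :=
  \max_(i < p.+1) \max_(j : 'I_(res_rank b i)) (a i j - i)%N.

Definition regularity_quot (K : fieldType) (m : nat) (gs : seq {mpoly K[m]})
  (r : nat) : Prop :=
  exists p b a d, @min_graded_free_res K m gs p b a d /\ @res_reg b p a = r.

(* Main.v *)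
From HB Require Import structures.
Require Import Defs.
From mathcomp Require Import all_boot all_order all_algebra.
From mathcomp Require Import ssrcomplements mpoly zify ring.
From Stdlib Require Import Classical ClassicalEpsilon.
Set Implicit Arguments. Unset Strict Implicit. Unset Printing Implicit Defensive.
Import Order.TTheory GRing.Theory.
Local Open Scope ring_scope.

(** G is the cone with apex a over the linear forest H made of a path of length l,
    r - l disjoint edges and c - r isolated vertices.  Its maximal cliques are the edges and
    isolated vertices of H with a added.  The ideal J_H is a complete intersection of r quadrics,
    and J_G is the intersection of the ideal of all 2-minors with (x_a, y_a) + J_H.  The sum of
    these two ideals is (x_a, y_a) plus an ideal of 2-minors, so its quotient and the quotient by
    all 2-minors are 1-regular, and the Mayer-Vietoris sequence gives S/J_G the regularity r of
    S/((x_a, y_a) + J_H).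

    Regularity is computed on Koszul homology, where H_i with coefficients of degree q is Tor_i in
    degree i + q; thus a module is rho-regular when every Koszul cycle with coefficients of degree
    above rho is a boundary.  The minimal resolution is built by choosing shortest
    homogeneous generating families of the successive syzygy modules: Koszul vanishing bounds the
    degrees of the generators, and makes the syzygies vanish after as many steps as variables. *)

(** The shape of H decouples the three invariants. An edge of H raises both the regularity and the
    number of cliques by one, an isolated vertex raises only the latter, and neither lengthens the
    long path when it is added off it. The cone makes the graph connected, and the two things it
    disturbs are absorbed by the bound 2: an induced path through the apex has at most 3 vertices,
    and the Mayer-Vietoris correction term is 1-regular, hence strictly below [r]. H is a linear
    forest because an edge {i, i+1} then brings in two new variables, so that its binomial is a
    nonzerodivisor modulo the earlier ones.

    Bounding the regularity from above is only half of the task: [r] has to be attained. A nonzero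
    homology class, starting from the class of 1 in S, is therefore transported along with the
    vanishing statements ([NQ] next to [RQ]). In the end it is compared with the resolution: if all
    twists were smaller, dimension shifting back from the end of the resolution would give vanishing
    in degree [r]. *)

Section MonomialOperators.
Variables (K : fieldType) (m : nat).
Local Notation S := {mpoly K[m]}.
Implicit Types (p f : S) (q : int) (i j : 'I_m).

(** Every operator below is determined by its values on monomials, so identities between operators
    reduce to monomials through [mono_ind]. *)
Definition linext (g : 'X_{1..m} -> S) p : S := \sum_(u <- msupp p) p@_u *: g u.

Lemma linextw g k p : (msize p <= k)%N ->
  linext g p = \sum_(u : 'X_{1..m < k}) p@_u *: g u.
Proof.
move=> le_pk; pose I := 'X_{1..m < k}.
rewrite /linext (big_mksub I) /=; first last.
- by move=> x /msize_mdeg_lt /leq_trans; apply.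
- by apply: msupp_uniq.
rewrite big_rmcond //= => i.
by move/memN_msupp_eq0 => ->; rewrite scale0r.
Qed.

Lemma linext_is_linear g : linear (linext g).
Proof.
move=> c p q; pose k := maxn (msize (c *: p + q)) (maxn (msize p) (msize q)).
rewrite !(@linextw _ k) ?leq_max ?leqnn ?orbT // scaler_sumr -big_split /=.
by apply: eq_bigr => u _; rewrite mcoeffD mcoeffZ scalerDl scalerA.
Qed.
HB.instance Definition _ g := GRing.isLinear.Build K S S _ (linext g) (linext_is_linear g).

Lemma linextX g u : linext g 'X_[u] = g u.
Proof. by rewrite /linext msuppX big_seq1 mcoeffX eqxx scale1r. Qed.

Lemma mono_ind (P : S -> Prop) : P 0 ->
  (forall c u p, P p -> P (c *: 'X_[u] + p)) -> forall p, P p.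
Proof. by move=> P0 PD; elim/mpolyind => // c u p _ _; apply: PD. Qed.

(* [Ev i] substitutes 0 for the variable i, [Dv i] divides by it the monomials that contain it
   and kills the others, [cz q] is the homogeneous component of degree q (zero for q < 0). *)
Definition Ev i := linext (fun u => if u i == 0%N then 'X_[u] else 0).
Definition Dv i := linext (fun u => if u i == 0%N then 0 else 'X_[u - U_(i)]).
Definition cz q := linext (fun u => if (mdeg u)%:Z == q then 'X_[u] else 0).

HB.instance Definition _ i := GRing.Linear.on (Ev i).
HB.instance Definition _ i := GRing.Linear.on (Dv i).
HB.instance Definition _ q := GRing.Linear.on (cz q).

Lemma EvX i u : Ev i 'X_[u] = if u i == 0%N then 'X_[u] else 0.
Proof. exact: linextX. Qed.
Lemma DvX i u : Dv i 'X_[u] = if u i == 0%N then 0 else 'X_[u - U_(i)].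
Proof. exact: linextX. Qed.
Lemma czX q u : cz q 'X_[u] = if (mdeg u)%:Z == q then 'X_[u] else 0.
Proof. exact: linextX. Qed.

Lemma mnm_subK (u : 'X_{1..m}) i : u i != 0%N -> (U_(i) + (u - U_(i)))%MM = u.
Proof.
move=> ui; apply/mnmP=> j; rewrite mnmDE mnmBE mnm1E.
by case: eqP => [<-|_] /=; lia.
Qed.

Lemma EvDv i p : p = Ev i p + 'X_i * Dv i p.
Proof.
elim/mono_ind: p => [|c u p IH]; first by rewrite !linear0 mulr0 addr0.
rewrite !linearD !linearZ /= {1}IH mulrDr addrACA; congr (_ + _).
rewrite -scalerAr -scalerDr EvX DvX; congr (_ *: _).
case: ifP => ui; first by rewrite mulr0 addr0.
by rewrite add0r -mpolyXD mnm_subK ?ui.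
Qed.

Lemma Ev_mulX i p : Ev i ('X_i * p) = 0.
Proof.
elim/mono_ind: p => [|c u p IH]; first by rewrite mulr0 linear0.
rewrite mulrDr -scalerAr linearD linearZ /= IH -mpolyXD EvX mnmDE mnm1E eqxx.
by rewrite addr0 scaler0.
Qed.

Lemma Dv_mulX i p : Dv i ('X_i * p) = p.
Proof.
elim/mono_ind: p => [|c u p IH]; first by rewrite mulr0 linear0.
rewrite mulrDr -scalerAr linearD linearZ /= IH -mpolyXD DvX mnmDE mnm1E eqxx /=.
by congr (_ *: 'X_[_] + _); apply/mnmP=> j; rewrite mnmBE mnmDE addKn.
Qed.

Lemma Ev_mul i f p : Ev i (f * p) = Ev i f * Ev i p.
Proof.
elim/mono_ind: f => [|c u f IH]; first by rewrite mul0r linear0 mul0r.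
rewrite mulrDl -scalerAl !linearD !linearZ /= IH mulrDl -scalerAl; congr (_ *: _ + _).
elim/mono_ind: p {IH} => [|d v p IH]; first by rewrite mulr0 linear0 mulr0.
rewrite mulrDr -scalerAr !linearD !linearZ /= IH mulrDr -scalerAr; congr (_ *: _ + _).
rewrite -mpolyXD !EvX mnmDE addn_eq0.
by case: (u i == _); case: (v i == _); rewrite /= ?mul0r ?mulr0 ?mpolyXD.
Qed.

Lemma Dv_Ev i p : Dv i (Ev i p) = 0.
Proof.
have := congr1 (Dv i) (EvDv i p); rewrite linearD /= Dv_mulX => h.
by apply: (addIr (Dv i p)); rewrite add0r -h.
Qed.

Lemma Dv_mul i f p : Ev i f = f -> Dv i (f * p) = f * Dv i p.
Proof.
move=> Ef; rewrite {1}(EvDv i p) mulrDr linearD /= mulrCA Dv_mulX.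
by rewrite -{1}Ef -Ev_mul Dv_Ev add0r.
Qed.

Lemma Ev_var i j : i != j -> Ev i 'X_j = 'X_j :> S.
Proof. by move=> ij; rewrite EvX mnm1E [j == i]eq_sym (negPf ij). Qed.

Lemma Ev_X i : Ev i 'X_i = 0 :> S.
Proof. by rewrite -[X in Ev i X]mulr1 Ev_mulX. Qed.

Lemma cz_id q q' p : cz q (cz q' p) = if q == q' then cz q p else 0.
Proof.
elim/mono_ind: p => [|c u p IH]; first by rewrite !linear0; case: ifP.
rewrite (linearD (cz q')) /= (linearD (cz q)) /= IH !linearZ /= (linearD (cz q)) linearZ /= !czX.
case: eqP => [uq|/eqP uq]; case: (eqVneq q q') => [qq|qq]; rewrite ?linear0 ?czX.
- by rewrite qq uq eqxx.
- by rewrite uq eq_sym (negPf qq) ?scaler0 addr0.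
- by rewrite qq (negPf uq) ?scaler0.
- by rewrite ?scaler0 ?addr0.
Qed.

Lemma cz_Ev q i p : cz q (Ev i p) = Ev i (cz q p).
Proof.
elim/mono_ind: p => [|c u p IH]; first by rewrite !linear0.
rewrite !(linearD, linearZ) /= IH czX EvX; congr (_ *: _ + _).
by case: ifP => ui; case: ifP => uq; rewrite ?linear0 ?czX ?EvX ?ui ?uq.
Qed.

Lemma cz_Dv q i p : cz q (Dv i p) = Dv i (cz (q + 1) p).
Proof.
elim/mono_ind: p => [|c u p IH]; first by rewrite !linear0.
rewrite !(linearD, linearZ) /= IH czX DvX; congr (_ *: _ + _).
case: ifP => ui; first by rewrite linear0; case: ifP; rewrite ?linear0 // DvX ui.
have := congr1 mdeg (mnm_subK (negbT ui)); rewrite mdegD mdeg1 czX => <-.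
by case: eqP; case: eqP; rewrite ?linear0 // ?DvX ?ui //; lia.
Qed.

Lemma cz_mul q (d : int) f p : cz d f = f -> cz (q + d) (f * p) = f * cz q p.
Proof.
move=> <-; elim/mono_ind: f => [|c u f IH]; first by rewrite linear0 !mul0r linear0.
rewrite !(linearD, linearZ) /= mulrDl linearD /= IH mulrDl; congr (_ + _).
rewrite -!scalerAl linearZ /=; congr (_ *: _).
rewrite czX; case: eqP => [ud|]; last by rewrite !mul0r linear0.
elim/mono_ind: p {IH} => [|e v p IH]; first by rewrite mulr0 !linear0 mulr0.
rewrite mulrDr !linearD /= IH mulrDr; congr (_ + _).
rewrite -scalerAr !linearZ /= -scalerAr; congr (_ *: _).
rewrite -mpolyXD !czX mdegD; case: eqP; case: eqP; rewrite ?mulr0 ?mpolyXD //; lia.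
Qed.

Lemma cz_var i : cz 1 'X_i = 'X_i :> S.
Proof. by rewrite czX mdeg1. Qed.

Lemma cz_neg q p : (q < 0)%R -> cz q p = 0.
Proof.
move=> q0; rewrite /cz /linext big1_seq // => u _.
by case: eqP => [uq|]; rewrite ?scaler0 //; lia.
Qed.

Lemma cz_sum p k : (msize p <= k)%N -> p = \sum_(d < k) cz d p.
Proof.
move=> pk; rewrite {1}[p]mpolyE; under [RHS]eq_bigr => d _ do rewrite /cz /linext.
rewrite exchange_big /= big_seq [RHS]big_seq; apply: eq_bigr => u up.
have uk : (mdeg u < k)%N by apply: leq_trans pk; exact: msize_mdeg_lt.
rewrite (bigD1 (Ordinal uk)) //= eqxx big1 ?addr0 // => d dk.
by case: eqP => [/eqP ud|]; rewrite ?scaler0 //; case/negP: dk; apply/eqP/val_inj => /=; lia.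
Qed.

Lemma coef_cz q p u : (cz q p)@_u = if (mdeg u)%:Z == q then p@_u else 0.
Proof.
elim/mono_ind: p => [|c v p IH]; first by rewrite linear0 mcoeff0; case: ifP.
rewrite linearD linearZ /= mcoeffD IH mcoeffZ mcoeffD mcoeffZ czX.
case: (eqVneq v u) => [->|vu]; first by case: ifP; rewrite ?mcoeffX ?eqxx ?mcoeff0 ?mulr0 ?addr0.
have -> : ('X_[v] : S)@_u = 0 by rewrite mcoeffX (negPf vu).
have -> : (if (mdeg v)%:Z == q then 'X_[v] else 0 : S)@_u = 0.
  by case: ifP; rewrite ?mcoeff0 // mcoeffX (negPf vu).
by case: ifP; rewrite ?mulr0 ?addr0.
Qed.

Lemma cz_homog d p : cz d%:Z p = p -> homog_of d p.
Proof.
move=> <-; apply/allP=> u; rewrite mcoeff_msupp coef_cz /=.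
by case: (_ =P d%:Z) => [[->]|_]; rewrite eqxx.
Qed.

Lemma cz0E p : cz 0 p = (p@_0%MM)%:MP.
Proof.
apply/mpolyP=> u; rewrite coef_cz mcoeffC [_ == 0%MM]eq_sym.
by rewrite eqz_nat mdeg_eq0 eq_sym; case: eqP => [->|_]; rewrite ?mulr1 ?mulr0.
Qed.

End MonomialOperators.

(** * Koszul complexes *)

Section Koszul.
Variables (K : fieldType) (m : nat).
Local Notation S := {mpoly K[m]}.
Implicit Types (i : 'I_m) (s : seq 'I_m).

(* The exterior algebra on the variables of [s], tensored with V: the pair (u, v) in
   [kos V (i :: s)] stands for u + e_i v. *)
Fixpoint kos (V : lmodType S) s : lmodType S :=
  if s is _ :: s' then (kos V s' * kos V s')%type : lmodType S else V.

(** The sign in the second component comes from moving the differential past e_i. *)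
Fixpoint kd (V : lmodType S) s : kos V s -> kos V s :=
  match s with
  | [::] => fun _ => 0
  | i :: s' => fun u => (kd u.1 + 'X_i *: u.2, - kd u.2)
  end.

Fixpoint kmap (V W : lmodType S) (f : V -> W) s : kos V s -> kos W s :=
  match s with
  | [::] => f
  | i :: s' => fun u => (kmap f u.1, kmap f u.2)
  end.

(** For a submodule [Z], [kall Z u] says that [u] vanishes in the Koszul complex of the quotient by
    [Z]; no quotient module has to be formed. *)
Fixpoint kall (V : lmodType S) (P : V -> Prop) s : kos V s -> Prop :=
  match s with
  | [::] => P
  | i :: s' => fun u => kall P u.1 /\ kall P u.2
  end.

Fixpoint kbot (V : lmodType S) s : kos V s -> V :=
  match s with [::] => id | i :: s' => fun u => kbot u.1 end.

Fixpoint kin (V : lmodType S) s (v : V) : kos V s :=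
  match s with [::] => v | i :: s' => (kin s' v, 0) end.

(* All components of u have exterior degree at least j. *)
Fixpoint klv (V : lmodType S) s (j : nat) : kos V s -> Prop :=
  match s with
  | [::] => fun u => (j == 0)%N \/ u = 0
  | i :: s' => fun u => klv j u.1 /\ klv j.-1 u.2
  end.

(* Exterior multiplication by e_i. *)
Fixpoint ke (V : lmodType S) i s : kos V s -> kos V s :=
  match s with
  | [::] => fun _ => 0
  | j :: s' => fun u => if i == j then (0, u.1) else (ke i u.1, - ke i u.2)
  end.

Definition addsub (V : lmodType S) (P : V -> Prop) :=
  P 0 /\ forall u v, P u -> P v -> P (u - v).

Section Basics.
Variables V W : lmodType S.

Lemma kd_linear s : linear (@kd V s).
Proof.
elim: s => [|i s IH] c u v; first by rewrite scaler0 addr0.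
case: u v => u1 u2 [v1 v2]; congr pair.
- transitivity (kd (c *: u1 + v1) + 'X_i *: (c *: u2 + v2)) => //=.
  by rewrite IH !scalerDr !scalerA [c * _]mulrC addrACA.
- transitivity (- kd (c *: u2 + v2)) => //=.
  by rewrite IH opprD scalerN.
Qed.
HB.instance Definition _ s := GRing.isLinear.Build S (kos V s) (kos V s) _ (@kd V s) (@kd_linear s).

Lemma kd_kd s (u : kos V s) : kd (kd u) = 0.
Proof.
elim: s u => [|i s IH] //= [u v] /=; congr pair.
- by rewrite linearD linearZ /= IH add0r scalerN addrN.
- by rewrite linearN /= IH !oppr0.
Qed.

Lemma ke_linear i s : linear (@ke V i s).
Proof.
elim: s => [|j s IH] c u v; first by rewrite scaler0 addr0.
case: u v => u1 u2 [v1 v2] /=; case: eqP => _; congr pair => /=.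
- by rewrite scaler0 addr0.
- by rewrite IH.
- by rewrite IH opprD scalerN.
Qed.
HB.instance Definition _ i s := GRing.isLinear.Build S (kos V s) (kos V s) _ (@ke V i s) (@ke_linear i s).

(** Exterior multiplication by e_i is a homotopy from multiplication by X_i to zero, so variables
    annihilate Koszul homology. *)
Lemma kd_ke i s (u : kos V s) : i \in s -> kd (ke i u) + ke i (kd u) = 'X_i *: u.
Proof.
elim: s u => [//|j s IH] [u v] /=; rewrite inE.
case: (eqVneq i j) => [-> _|ij /= is_]; congr pair => /=.
- by rewrite linear0 add0r addr0.
- by rewrite addrA addNr add0r.
- by rewrite linearD linearZ /= scalerN addrACA IH // addNr addr0.
- by rewrite !linearN /= !opprK IH.
Qed.

Lemma kmap_additive (f : {additive V -> W}) s : additive (@kmap V W f s).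
Proof.
elim: s => [|i s IH] u v; first exact: raddfB.
by case: u v => u1 u2 [v1 v2] /=; congr pair; apply: IH.
Qed.
HB.instance Definition _ (f : {additive V -> W}) s :=
  GRing.isZmodMorphism.Build (kos V s) (kos W s) (@kmap V W f s) (@kmap_additive f s).

Lemma kmapZ (f : V -> W) s (c : S) (u : kos V s) :
  (forall v, f (c *: v) = c *: f v) -> kmap f (c *: u) = c *: kmap f u.
Proof. by move=> fc; elim: s u => [|i s IH] u //=; rewrite !IH. Qed.

Lemma kmap_kd (f : {additive V -> W}) s (u : kos V s) :
  (forall i v, i \in s -> f ('X_i *: v) = 'X_i *: f v) -> kmap f (kd u) = kd (kmap f u).
Proof.
elim: s u => [u _|i s IH [u v] fi] /=; first exact: raddf0.
have fi' (j : 'I_m) v0 : j \in s -> f ('X_j *: v0) = 'X_j *: f v0.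
  by move=> js; apply: fi; rewrite inE js orbT.
congr pair; last by rewrite raddfN /= IH.
by rewrite raddfD /= IH // kmapZ // => w; apply: fi; rewrite inE eqxx.
Qed.

Lemma kbot_kmap (f : V -> W) s (u : kos V s) : kbot (kmap f u) = f (kbot u).
Proof. by elim: s u => [|i s IH] u //=. Qed.

Lemma kbot_sub s (u v : kos V s) : kbot (u - v) = kbot u - kbot v.
Proof. by elim: s u v => [|i s IH] u v //=. Qed.

Lemma kall_imp (P Q : V -> Prop) s (u : kos V s) :
  (forall v, P v -> Q v) -> kall P u -> kall Q u.
Proof. by move=> PQ; elim: s u => [|i s IH] u //=; [apply: PQ | case=> /IH ? /IH]. Qed.

Lemma kall_and (P Q : V -> Prop) s (u : kos V s) :
  kall P u -> kall Q u -> kall (fun v => P v /\ Q v) u.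
Proof. by elim: s u => [|i s IH] u //= [? ?] [? ?]; split; apply: IH. Qed.

Lemma kall_bot (P : V -> Prop) s (u : kos V s) : kall P u -> P (kbot u).
Proof. by elim: s u => [|i s IH] u //= [/IH]. Qed.

Lemma kall0 (P : V -> Prop) s : P 0 -> kall P (0 : kos V s).
Proof. by move=> P0; elim: s => [|i s IH] //=. Qed.

Lemma kall_in (P : V -> Prop) s v : P 0 -> P v -> kall P (kin s v).
Proof. by move=> P0 Pv; elim: s => [|i s IH] //=; split=> //; apply: kall0. Qed.

Lemma kallB (P : V -> Prop) s (u v : kos V s) :
  addsub P -> kall P u -> kall P v -> kall P (u - v).
Proof.
by move=> [P0 PB]; elim: s u v => [|i s IH] u v //=; [apply: PB | case=> ? ? [? ?]; split; apply: IH].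
Qed.

Lemma kallN (P : V -> Prop) s (u : kos V s) : addsub P -> kall P u -> kall P (- u).
Proof. by move=> Pa Pu; rewrite -[- u]add0r; apply: kallB => //; apply: kall0; case: Pa. Qed.

Lemma kallD (P : V -> Prop) s (u v : kos V s) :
  addsub P -> kall P u -> kall P v -> kall P (u + v).
Proof. by move=> Pa Pu Pv; rewrite -[v]opprK; apply: kallB => //; apply: kallN. Qed.

Lemma kallZ (P Q : V -> Prop) (c : S) s (u : kos V s) :
  (forall v, P v -> Q (c *: v)) -> kall P u -> kall Q (c *: u).
Proof. by move=> PQ; elim: s u => [|i s IH] u //=; [apply: PQ | case=> ? ?; split; apply: IH]. Qed.

Lemma kall_kd (P Q : V -> Prop) s (u : kos V s) : addsub Q ->
  (forall i v, P v -> Q ('X_i *: v)) -> kall P u -> kall Q (kd u).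
Proof.
move=> Qa PQ; elim: s u => [|i s IH] u /=; first by case: Qa.
case=> P1 P2; split; last by apply/kallN/IH.
by apply: kallD => //; [apply: IH | apply: kallZ P2; apply: PQ].
Qed.

Lemma kall_ke (P : V -> Prop) i s (u : kos V s) : addsub P -> kall P u -> kall P (ke i u).
Proof.
move=> Pa; elim: s u => [|j s IH] u /=; first by case: Pa.
case=> P1 P2; case: eqP => _ /=; split=> //; first by apply: kall0; case: Pa.
- exact: IH.
- by apply/kallN/IH.
Qed.

Lemma kall_map (f : V -> W) (P : V -> Prop) (Q : W -> Prop) s (u : kos V s) :
  (forall v, P v -> Q (f v)) -> kall P u -> kall Q (kmap f u).
Proof. by move=> PQ; elim: s u => [|i s IH] u //=; [apply: PQ | case=> ? ?; split; apply: IH]. Qed.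

Lemma kmap_id s (u : kos V s) : kmap id u = u.
Proof. by elim: s u => [|i s IH] //= [u v] /=; rewrite !IH. Qed.

Lemma kmap_add (f g : V -> W) s (u : kos V s) :
  kmap f u + kmap g u = kmap (fun v => f v + g v) u.
Proof. by elim: s u => [|i s IH] //= [u v] /=; rewrite -!IH. Qed.

Lemma kmap_scale (c : S) s (u : kos V s) : kmap ( *:%R c) u = c *: u.
Proof. by elim: s u => [|i s IH] //= [u v] /=; rewrite !IH. Qed.

Lemma kmap_ext (f g : V -> W) s (u : kos V s) : f =1 g -> kmap f u = kmap g u.
Proof. by move=> fg; elim: s u => [|i s IH] u //=; rewrite !IH. Qed.

Lemma kmap0 s (u : kos V s) : kmap (fun _ => 0 : W) u = 0.
Proof. by elim: s u => [|i s IH] u //=; rewrite !IH. Qed.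

Lemma kin0 s : kin s (0 : V) = 0.
Proof. by elim: s => [|i s IH] //=; rewrite IH. Qed.

Lemma klv0 s (u : kos V s) : klv 0 u.
Proof. by elim: s u => [|i s IH] u //=; left. Qed.

Lemma klv_big s (j : nat) (u : kos V s) : (size s < j)%N -> klv j u -> u = 0.
Proof.
elim: s j u => [|i s IH] j u /=; first by move=> j0 [/eqP j1|//]; rewrite j1 in j0.
case: j u => //= j [u v] sj [/= lu lv].
by rewrite (IH _ u _ lu) ?(IH _ v _ lv) //; apply: ltnW.
Qed.

Lemma klv_zero s (j : nat) : klv j (0 : kos V s).
Proof. by elim: s j => [|i s IH] j /=; [right | split; apply: IH]. Qed.

Lemma klvD s (j : nat) (u v : kos V s) : klv j u -> klv j v -> klv j (u + v).
Proof.
elim: s j u v => [|i s IH] j u v /=; last by case=> ? ? [? ?]; split; apply: IH.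
by case=> [->|->] [j0|->]; [left|left|left|right; rewrite addr0].
Qed.

Lemma klvZ s (j : nat) c (u : kos V s) : klv j u -> klv j (c *: u).
Proof.
elim: s j u => [|i s IH] j u /=; last by case=> ? ?; split; apply: IH.
by case=> [->|->]; [left|right; rewrite scaler0].
Qed.

Lemma klvN s (j : nat) (u : kos V s) : klv j u -> klv j (- u).
Proof. by rewrite -scaleN1r; apply: klvZ. Qed.

Lemma klv_kd s (j : nat) (u : kos V s) : klv j.+1 u -> klv j (kd u).
Proof.
elim: s j u => [|i s IH] j u /=; first by right.
case=> lu lv; split; first by apply: klvD; [apply: IH | apply: klvZ].
by apply: klvN; case: j lv {lu} => [|j] lv; [apply: klv0 | apply: IH].
Qed.

Lemma klv_map (f : {additive V -> W}) s (j : nat) (u : kos V s) : klv j u -> klv j (kmap f u).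
Proof.
elim: s j u => [|i s IH] j u /=; last by case=> ? ?; split; apply: IH.
by case=> [->|->]; [left|right; rewrite raddf0].
Qed.

End Basics.

Lemma kall_comp (U V : lmodType S) (f : U -> V) (P : V -> Prop) s (u : kos U s) :
  kall P (kmap f u) -> kall (fun v => P (f v)) u.
Proof. by elim: s u => [|i s IH] u //= [/IH ? /IH]. Qed.

Lemma kmap_comp (U V W : lmodType S) (f : U -> V) (g : V -> W) s (u : kos U s) :
  kmap g (kmap f u) = kmap (fun v => g (f v)) u.
Proof. by elim: s u => [|i s IH] u //=; rewrite !IH. Qed.

Lemma kall_split (V W : lmodType S) (f : {additive W -> V}) (P A : V -> Prop) (B : W -> Prop) :
  (forall v, P v -> exists2 w, B w & A (v - f w)) ->
  forall s (u : kos V s), kall P u -> exists2 w, kall B w & kall A (u - kmap f w).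
Proof.
move=> PAB; elim=> [|i s IH] u /=; first exact: PAB.
by case=> /IH[w1 B1 A1] /IH[w2 B2 A2]; exists (w1, w2).
Qed.

(** Zero components are lifted to zero, so that the lift keeps the exterior degree. *)
Lemma kall_split_lv (V W : lmodType S) (f : {additive W -> V}) (P : V -> Prop) (B : W -> Prop) :
  B 0 -> (forall v, P v -> exists2 w, B w & v = f w) ->
  forall s j (u : kos V s), klv j u -> kall P u ->
  exists w, [/\ klv j w, kall B w & u = kmap f w].
Proof.
move=> B0 PAB; elim=> [|i s IH] j u /=.
  case=> [j0 /PAB[w Bw ->]|-> _]; first by exists w; split=> //; left.
  by exists 0; split; [right | | rewrite raddf0].
case: u => u v /= [lu lv] [Pu Pv].
have [w1 [? ? ->]] := IH _ _ lu Pu; have [w2 [? ? ->]] := IH _ _ lv Pv.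
by exists (w1, w2).
Qed.

End Koszul.

(** * Graded free modules and the contraction of their Koszul complexes *)

Section GradedRows.
Variables (K : fieldType) (m : nat).
Local Notation S := {mpoly K[m]}.
Implicit Types (q : int) (i : 'I_m) (s : seq 'I_m).

(* The component of degree q of the free module with a generator of degree [a k] for each k. *)
Definition rcz b (a : 'I_b -> nat) q (v : 'rV[S]_b) : 'rV[S]_b :=
  \row_k cz (q - (a k)%:Z) (v 0 k).
Definition rE b i (v : 'rV[S]_b) : 'rV[S]_b := map_mx (Ev i) v.
Definition rD b i (v : 'rV[S]_b) : 'rV[S]_b := map_mx (Dv i) v.

Lemma rcz_additive b a q : additive (@rcz b a q).
Proof. by move=> u v; apply/rowP=> k; rewrite !mxE linearB. Qed.
HB.instance Definition _ b a q := GRing.isZmodMorphism.Build 'rV[S]_b 'rV[S]_b _ (@rcz_additive b a q).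
Lemma rE_additive b i : additive (@rE b i).
Proof. by move=> u v; apply/rowP=> k; rewrite !mxE linearB. Qed.
HB.instance Definition _ b i := GRing.isZmodMorphism.Build 'rV[S]_b 'rV[S]_b _ (@rE_additive b i).
Lemma rD_additive b i : additive (@rD b i).
Proof. by move=> u v; apply/rowP=> k; rewrite !mxE linearB. Qed.
HB.instance Definition _ b i := GRing.isZmodMorphism.Build 'rV[S]_b 'rV[S]_b _ (@rD_additive b i).

Section OneModule.
Variables (b : nat) (a : 'I_b -> nat).
Implicit Types (v : 'rV[S]_b) (Z : 'rV[S]_b -> Prop).

Definition rhom q v := rcz a q v = v.

Lemma addsub_hom q : addsub (rhom q).
Proof. by split=> [|u v hu hv]; rewrite /rhom ?raddf0 // raddfB /= hu hv. Qed.

Lemma rcz_id q q' v : rcz a q (rcz a q' v) = if q == q' then rcz a q v else 0.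
Proof.
apply/rowP=> k; rewrite !mxE cz_id (inj_eq (addIr _)).
by case: eqP => _; rewrite !mxE.
Qed.

Lemma hom_rcz q v : rhom q (rcz a q v).
Proof. by rewrite /rhom rcz_id eqxx. Qed.

Lemma hom_neq q q' v : rhom q v -> q' != q -> rcz a q' v = 0.
Proof. by move=> <- qq; rewrite rcz_id (negPf qq). Qed.

Lemma rczM q (d : int) (f : S) v : cz d f = f -> rcz a (q + d) (f *: v) = f *: rcz a q v.
Proof. by move=> fd; apply/rowP=> k; rewrite !mxE addrAC cz_mul. Qed.

Lemma rczM' q (d : int) (f : S) v : cz d f = f -> rcz a q (f *: v) = f *: rcz a (q - d) v.
Proof. by move=> /rczM <-; rewrite subrK. Qed.

Lemma homM q (d : int) (f : S) v : cz d f = f -> rhom q v -> rhom (q + d) (f *: v).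
Proof. by move=> fd hv; rewrite /rhom rczM // hv. Qed.

Lemma rcz_rE q i v : rcz a q (rE i v) = rE i (rcz a q v).
Proof. by apply/rowP=> k; rewrite !mxE cz_Ev. Qed.
Lemma rcz_rD q i v : rcz a q (rD i v) = rD i (rcz a (q + 1) v).
Proof. by apply/rowP=> k; rewrite !mxE cz_Dv addrAC. Qed.

Lemma hom_rE q i v : rhom q v -> rhom q (rE i v).
Proof. by rewrite /rhom rcz_rE => ->. Qed.
Lemma hom_rD q i v : rhom q v -> rhom (q - 1) (rD i v).
Proof. by rewrite /rhom rcz_rD subrK => ->. Qed.

Lemma row_EvDv i v : v = rE i v + 'X_i *: rD i v.
Proof. by apply/rowP=> k; rewrite !mxE -EvDv. Qed.
Lemma rE_mulX i v : rE i ('X_i *: v) = 0.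
Proof. by apply/rowP=> k; rewrite !mxE Ev_mulX. Qed.
Lemma rD_mulX i v : rD i ('X_i *: v) = v.
Proof. by apply/rowP=> k; rewrite !mxE Dv_mulX. Qed.
Lemma rE_free i (f : S) v : Ev i f = f -> rE i (f *: v) = f *: rE i v.
Proof. by move=> fi; apply/rowP=> k; rewrite !mxE Ev_mul fi. Qed.
Lemma rD_free i (f : S) v : Ev i f = f -> rD i (f *: v) = f *: rD i v.
Proof. by move=> fi; apply/rowP=> k; rewrite !mxE Dv_mul. Qed.

Lemma row_sum v : exists n : nat, v = \sum_(d < n) rcz a d%:Z v.
Proof.
pose n := (\max_k (a k + msize (v 0%R k)))%N; exists n.
apply/rowP=> k; rewrite summxE; under eq_bigr => d _ do rewrite mxE.
have le_n : (a k + msize (v 0%R k) <= n)%N.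
  by apply: (leq_bigmax_cond (F := fun k => a k + msize (v 0%R k))%N).
have -> : n = (a k + (n - a k))%N by lia.
rewrite big_split_ord /= big1 ?add0r; last by move=> d _; apply: cz_neg; have := ltn_ord d; lia.
under eq_bigr => d _ do rewrite PoszD [_ + d%:Z]addrC addrK.
by apply: cz_sum; lia.
Qed.

Fixpoint Evs s (p : S) : S := if s is i :: s' then Evs s' (Ev i p) else p.

Lemma coef_Ev i (p : S) (u : 'X_{1..m}) : (Ev i p)@_u = if u i == 0%N then p@_u else 0.
Proof.
elim/mono_ind: p => [|c t p IH]; first by rewrite linear0 mcoeff0; case: ifP.
rewrite linearD linearZ /= !mcoeffD IH !mcoeffZ EvX.
case: (eqVneq t u) => [->|tu]; first by case: ifP; rewrite ?mcoeffX ?eqxx ?mcoeff0 ?mulr0 ?addr0.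
have -> : ('X_[t] : S)@_u = 0 by rewrite mcoeffX (negPf tu).
have -> : (if t i == 0%N then 'X_[t] else 0 : S)@_u = 0.
  by case: ifP; rewrite ?mcoeff0 // mcoeffX (negPf tu).
by case: ifP; rewrite ?mulr0 ?addr0.
Qed.

Lemma coef_Evs s (p : S) (u : 'X_{1..m}) : (Evs s p)@_u = if all (fun i => u i == 0%N) s then p@_u else 0.
Proof.
elim: s p => [|i s IH] p //=; rewrite IH coef_Ev.
by case: (u i == 0%N); case: all.
Qed.

Lemma Evs_enum (p : S) : Evs (enum 'I_m) p = cz 0 p.
Proof.
apply/mpolyP=> u; rewrite coef_Evs coef_cz eqz_nat mdeg_eq0.
congr (if _ then _ else _); apply/allP/eqP => [h|-> i _]; last by rewrite mnm0E.
by apply/mnmP=> i; rewrite mnm0E; apply/eqP/h; rewrite mem_enum.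
Qed.

(* A contracting homotopy of the Koszul complex of a free module. *)
Fixpoint kh s : kos 'rV[S]_b s -> kos 'rV[S]_b s :=
  match s with
  | [::] => fun _ => 0
  | i :: s' => fun z => (kh (kmap (@rE b i) z.1), kmap (@rD b i) z.1)
  end.

(** For a cycle u + e_i v one has d u + X_i v = 0. Setting X_i to 0 shows that [rE i] of u is a
    cycle over the remaining variables, where induction applies; dividing by X_i gives v = - d
    ([rD i] of u). Once all variables are used up, only the part of the bottom component free of
    them is left. *)
Lemma kh_homotopy s (z : kos 'rV[S]_b s) : uniq s -> kd z = 0 ->
  z = kd (kh z) + kin s (map_mx (Evs s) (kbot z)).
Proof.
elim: s z => [|i s IH]; first by move=> z _ _ /=; rewrite add0r map_mx_id.
case=> u v /= /andP[nis us] dz.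
have {dz}[dz1 dz2] : kd u + 'X_i *: v = 0 /\ kd v = 0.
  by case: dz => -> /eqP; rewrite oppr_eq0 => /eqP->.
have free (f : {additive 'rV[S]_b -> 'rV[S]_b}) (w : kos 'rV[S]_b s) :
    (forall j u, j != i -> f ('X_j *: u) = 'X_j *: f u) -> kmap f (kd w) = kd (kmap f w).
  by move=> fi; apply: kmap_kd => j x js; apply: fi; apply: contraNneq nis => <-.
have dE : kd (kmap (@rE b i) u) = 0.
  rewrite -free; last by move=> j x ji /=; rewrite rE_free // Ev_var // eq_sym.
  have := congr1 (kmap (@rE b i) (s := s)) dz1; rewrite raddfD raddf0 /= => <-.
  rewrite -(kmap_scale 'X_i) kmap_comp [X in _ = _ + X](_ : _ = kmap (fun _ => 0) v).
    by rewrite kmap0 addr0.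
  by apply: kmap_ext => x; rewrite rE_mulX.
have dD : kd (kmap (@rD b i) u) + v = 0.
  rewrite -free; last by move=> j x ji /=; rewrite rD_free // Ev_var // eq_sym.
  have := congr1 (kmap (@rD b i) (s := s)) dz1; rewrite raddfD raddf0 /= => <-.
  rewrite -[in X in _ = _ + X](kmap_scale 'X_i) kmap_comp -[LHS](congr1 (+%R _) (kmap_id v)).
  by congr (_ + _); apply: kmap_ext => x; rewrite rD_mulX.
have {}IH := IH _ us dE; congr pair; last first.
  by rewrite /= addr0; apply/eqP; rewrite -addr_eq0 addrC dD.
rewrite /= addrAC.
have -> : map_mx (fun p => Evs s (Ev i p)) (kbot u) = map_mx (Evs s) (kbot (kmap (@rE b i) u)).
  by rewrite kbot_kmap; apply/rowP=> k; rewrite !mxE.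
rewrite -IH -kmap_scale kmap_comp kmap_add -{1}[u]kmap_id.
by apply: kmap_ext => x; rewrite -row_EvDv.
Qed.

Lemma kh_hom s q (z : kos 'rV[S]_b s) : kall (rhom q) z -> kall (rhom (q - 1)) (kh z).
Proof.
elim: s z => [|i s IH] z /=; first by rewrite /rhom raddf0.
case=> h1 h2; split; first by apply/IH/(kall_map _ h1) => v; apply: hom_rE.
by apply: kall_map h1 => v; apply: hom_rD.
Qed.

Lemma kh_lv s (j : nat) (z : kos 'rV[S]_b s) : klv j z -> klv j.+1 (kh z).
Proof.
elim: s j z => [|i s IH] j z /=; first by right.
by case=> l1 l2; split; [apply/IH/klv_map | apply/klv_map].
Qed.

Local Notation X := (enum 'I_m).
Local Notation kosX := (kos 'rV[S]_b X).

Lemma koszul_exact (z : kosX) : kd z = 0 -> (forall k, cz 0 (kbot z 0 k) = 0) ->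
  z = kd (kh z).
Proof.
move=> dz z0; rewrite {1}(kh_homotopy (enum_uniq _) dz) (_ : map_mx _ _ = 0).
  by rewrite kin0 addr0.
by apply/rowP=> k; rewrite !mxE Evs_enum.
Qed.

(** Above the degrees of the generators the bottom component has no constant term, which is the only
    obstruction to exactness. *)
Lemma koszul_exact_hom q (z : kosX) : kd z = 0 -> kall (rhom q) z ->
  (forall k, (a k)%:Z < q) -> z = kd (kh z).
Proof.
move=> dz hz aq; apply: koszul_exact => // k.
have /rowP/(_ k) := kall_bot hz; rewrite !mxE => <-.
by rewrite cz_id; case: eqP => // q0; have := aq k; lia.
Qed.

Definition gsub Z :=
  [/\ addsub Z, forall (c : S) v, Z v -> Z (c *: v) & forall q v, Z v -> Z (rcz a q v)].

(* The quotient by Z is rho-regular: its Koszul homology vanishes where the coefficients have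
   degree above rho (as Tor_i in degree i + q is the Koszul homology H_i with coefficients in
   degree q, the exterior degree plays no role).  [NQ] says that rho is attained. *)
Definition RQ Z (rho : int) := forall q (z : kosX), (rho < q)%R ->
  kall (rhom q) z -> kall Z (kd z) ->
  exists2 w : kosX, kall (rhom (q - 1)) w & kall Z (z - kd w).

Definition NQ Z (rho : int) := exists z : kosX, [/\ kall (rhom rho) z, kall Z (kd z) &
  forall w : kosX, ~ kall Z (z - kd w)].

Lemma hom_kd s q (z : kos 'rV[S]_b s) : kall (rhom q) z -> kall (rhom (q + 1)) (kd z).
Proof.
apply: kall_kd; first exact: addsub_hom.
by move=> i v; apply: homM; rewrite cz_var.
Qed.

Lemma kall_kdZ Z s (z : kos 'rV[S]_b s) : gsub Z -> kall Z z -> kall Z (kd z).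
Proof. by case=> Za Zm _; apply: kall_kd => // i v; apply: Zm. Qed.

End OneModule.
End GradedRows.

(** * Change of regularity along exact sequences *)

Section RegularityRules.
Variables (K : fieldType) (m b : nat) (a : 'I_b -> nat).
Local Notation S := {mpoly K[m]}.
Local Notation X := (enum 'I_m).
Local Notation kosX := (kos 'rV[S]_b X).
Implicit Types (q d rho : int) (f g h : S) (Z : 'rV[S]_b -> Prop).

Definition zadd Z f (v : 'rV[S]_b) := exists w, Z (v - f *: w).
Definition zsum Z1 Z2 (v : 'rV[S]_b) := exists2 w, Z2 w & Z1 (v - w).

Lemma add_cancel (U : zmodType) (x y z : U) : x + (- y - z) - x = - (y + z).
Proof. by rewrite addrAC subrr add0r opprD. Qed.

Lemma scale_cancel (U : lmodType S) f (y z u : U) :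
  f *: (z - u) = (y - f *: u) - (y - f *: z).
Proof. by rewrite scalerBr opprB [RHS]addrC addrA addrNK. Qed.

Lemma kall_scaleE Z f (u : kosX) : (forall v, Z (f *: v) -> Z v) ->
  kall Z (f *: u) -> kall Z u.
Proof. by move=> nz; rewrite -kmap_scale => /kall_comp; apply: kall_imp. Qed.

Lemma kall_zadd Z f (u w : kosX) : kall Z (u - f *: w) -> kall (zadd Z f) u.
Proof.
elim: (X) u w => [|i s IH] u w /=; first by exists w.
by case=> ? ?; split; [apply: (IH _ w.1) | apply: (IH _ w.2)].
Qed.

Lemma zadd_split Z f (u : kosX) : kall (zadd Z f) u -> exists w, kall Z (u - f *: w).
Proof.
case/(@kall_split _ _ _ _ ( *:%R f) (zadd Z f) Z (fun _ => True)) => [v [w ?]|w _].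
  by exists w.
by rewrite kmap_scale; exists w.
Qed.

Lemma zadd_split_hom Z f d q (u : kosX) : gsub a Z -> cz d f = f ->
  kall (rhom a q) u -> kall (zadd Z f) u ->
  exists2 w, kall (rhom a (q - d)) w & kall Z (u - f *: w).
Proof.
move=> [_ _ Zc] fd hu Zu.
have [v [hv [w Zw]]|w hw] :=
  @kall_split _ _ _ _ ( *:%R f) (fun v => rhom a q v /\ zadd Z f v) Z (rhom a (q - d)) _ _ u (kall_and hu Zu).
  exists (rcz a (q - d) w); first exact: hom_rcz.
  by have := Zc q _ Zw; rewrite raddfB /= hv (rczM' _ _ _ fd).
by rewrite kmap_scale; exists w.
Qed.

Lemma zsum_split_hom Z1 Z2 q (u : kosX) : gsub a Z1 -> gsub a Z2 ->
  kall (rhom a q) u -> kall (zsum Z1 Z2) u ->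
  exists w, [/\ kall (rhom a q) w, kall Z2 w & kall Z1 (u - w)].
Proof.
move=> [_ _ Z1c] [_ _ Z2c] hu Zu.
have [v [hv [w Z2w Z1w]]|w hw] := @kall_split _ _ _ _ idfun
    (fun v => rhom a q v /\ zsum Z1 Z2 v) Z1 (fun w => rhom a q w /\ Z2 w) _ _ u (kall_and hu Zu).
  exists (rcz a q w); first by split; [exact: hom_rcz | exact: Z2c].
  by have := Z1c q _ Z1w; rewrite raddfB /= hv.
rewrite (kmap_id w) => ?; exists w; split=> //.
  by apply: kall_imp hw => ? [].
by apply: kall_imp hw => ? [].
Qed.

Lemma RQ_ext Z Z' rho : (forall v, Z v <-> Z' v) -> RQ a Z rho -> RQ a Z' rho.
Proof.
move=> ZZ' R q z rq hz /(kall_imp (fun v => proj2 (ZZ' v))) dz.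
have [w hw Zw] := R q z rq hz dz.
by exists w => //; apply: kall_imp Zw => v /ZZ'.
Qed.

Lemma NQ_ext Z Z' rho : (forall v, Z v <-> Z' v) -> NQ a Z rho -> NQ a Z' rho.
Proof.
move=> ZZ' [z [hz dz nz]]; exists z; split=> //; first by apply: kall_imp dz => v /ZZ'.
by move=> w Zw; apply: (nz w); apply: kall_imp Zw => v /ZZ'.
Qed.

Lemma RQ_le Z rho rho' : rho <= rho' -> RQ a Z rho -> RQ a Z rho'.
Proof. by move=> le R q z rq; apply: R; apply: le_lt_trans rq. Qed.

(** A cycle z modulo Z + (f) has d z = f w modulo Z, and w is a cycle modulo Z since f is a
    nonzerodivisor. Its degree q + 1 - d exceeds rho, so w is d u modulo Z; then z - f u is a cycle
    modulo Z, hence a boundary. *)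
Lemma RQ_zadd Z f d rho : gsub a Z -> 1 <= d -> cz d f = f ->
  (forall v, Z (f *: v) -> Z v) -> RQ a Z rho -> RQ a (zadd Z f) (rho + d - 1).
Proof.
move=> Zg d1 fd nz R q z rq hz dz; have [Za Zm _] := Zg.
have hdz := hom_kd hz.
have [w hw Zw] := zadd_split_hom Zg fd hdz dz.
have Zdw : kall Z (kd w).
  apply: (kall_scaleE nz); rewrite -[_ *: _]opprK; apply: kallN => //.
  by have := kall_kdZ Zg Zw; rewrite linearB /= kd_kd sub0r linearZ.
have [|u hu Zu] := R _ _ _ hw Zdw; first by lia.
have hz' : kall (rhom a q) (z - f *: u).
  apply: kallB => //; first exact: addsub_hom.
  apply: kallZ hu => v /(homM fd); congr rhom; lia.
have Zdz' : kall Z (kd (z - f *: u)).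
  rewrite linearB linearZ /= -[kd z](subrK (f *: w)) -addrA -scalerBr.
  by apply: kallD => //; apply: kallZ Zu => v; apply: Zm.
have [|v hv Zv] := R q _ _ hz' Zdz'; first by lia.
by exists v => //; apply: (@kall_zadd _ _ _ u); rewrite addrAC.
Qed.

(** Multiplication by f is null-homotopic, so the class of z lifts along the connecting map from the
    homology modulo Z + (f) to the homology modulo Z. Writing f with two variables covers both the
    edge binomials and, with a zero second term, the variables. *)
Lemma NQ_zadd Z f d rho g h (i j : 'I_m) : gsub a Z -> cz (d - 1) g = g -> cz (d - 1) h = h ->
  f = 'X_i * g + 'X_j * h ->
  (forall v, Z (f *: v) -> Z v) -> NQ a Z rho -> NQ a (zadd Z f) (rho + d - 1).
Proof.
move=> Zg gd hd fE nz [z [hz dz nbz]]; have [Za Zm _] := Zg.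
(* The homotopy for f applied to z: modulo Z, d y = f z, so y is a cycle modulo Z + (f). *)
pose y := g *: ke i z + h *: ke j z.
have dy : kall Z (kd y - f *: z).
  have -> : kd y - f *: z = - (g *: ke i (kd z) + h *: ke j (kd z)).
    have e k : kd (ke k z) = 'X_k *: z - ke k (kd z) by rewrite -kd_ke ?mem_enum // addrK.
    rewrite /y linearD !linearZ /= !e fE scalerDl !scalerBr !scalerA [g * _]mulrC [h * _]mulrC.
    by rewrite !scalerN -opprD addrACA; apply: add_cancel.
  apply: kallN => //; apply: kallD => //; apply: (kallZ (P := Z)); rewrite ?Za //.
  - by move=> v; apply: Zm.
  - exact: kall_ke.
  - by move=> v; apply: Zm.
  - exact: kall_ke.
exists y; split.
- have ah := @addsub_hom K m b a.
  have -> : rho + d - 1 = rho + (d - 1) by lia.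
  by apply: kallD => //; apply: (kallZ (P := rhom a rho)); try exact: kall_ke; move=> v; apply: homM.
- exact: kall_zadd dy.
- move=> w /zadd_split[u Zu]; apply: (nbz u); apply: (kall_scaleE nz).
  have Z1 : kall Z (kd y - f *: kd u).
    by have := kall_kdZ Zg Zu; rewrite !linearB /= kd_kd subr0 linearZ.
  by rewrite (scale_cancel f (kd y)); apply: kallB.
Qed.

(** Modulo Z, z is d w + X_i u, where u is a cycle because X_i is a nonzerodivisor; then X_i u is
    the boundary of e_i u. *)
Lemma RQ_of_zadd_var Z (i : 'I_m) rho : gsub a Z -> (forall v, Z ('X_i *: v) -> Z v) ->
  RQ a (zadd Z 'X_i) rho -> RQ a Z rho.
Proof.
move=> Zg nz R q z rq hz dz; have [Za Zm _] := Zg.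
have dz' : kall (zadd Z 'X_i) (kd z).
  by apply: kall_imp dz => v Zv; exists 0; rewrite scaler0 subr0.
have [w hw Zw] := R q z rq hz dz'.
have hzw : kall (rhom a q) (z - kd w).
  apply: kallB => //; first exact: addsub_hom.
  by have := hom_kd hw; rewrite subrK.
have [u hu Zu] := zadd_split_hom Zg (cz_var K i) hzw Zw.
have Zdu : kall Z (kd u).
  apply: (kall_scaleE nz); rewrite -[_ *: _](subKr (kd z)).
  apply: kallB => //; have := kall_kdZ Zg Zu.
  by rewrite !linearB /= kd_kd subr0 linearZ.
exists (w + ke i u).
  apply: kallD => //; first exact: addsub_hom.
  by apply: kall_ke hu; exact: addsub_hom.
rewrite (_ : z - _ = (z - kd w - 'X_i *: u) + ke i (kd u)).
  by apply: kallD => //; apply: kall_ke.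
by rewrite -kd_ke ?mem_enum // linearD /= !opprD !addrA subrK.
Qed.

(** This is the exact sequence in which multiplication by f embeds F/(Z : f), shifted by one, into
    F/Z with cokernel F/(Z + f F), where F is the free module. *)
Lemma RQ_of_colon Z f rho : gsub a Z -> cz 1 f = f ->
  RQ a (fun v => Z (f *: v)) (rho - 1) -> RQ a (zadd Z f) rho -> RQ a Z rho.
Proof.
move=> Zg fd Rc R q z rq hz dz; have [Za Zm _] := Zg.
have dz' : kall (zadd Z f) (kd z).
  by apply: kall_imp dz => v Zv; exists 0; rewrite scaler0 subr0.
have [w hw Zw] := R q z rq hz dz'.
have hzw : kall (rhom a q) (z - kd w).
  apply: kallB => //; first exact: addsub_hom.
  by have := hom_kd hw; rewrite subrK.
have [u hu Zu] := zadd_split_hom Zg fd hzw Zw.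
have Zdu : kall (fun v => Z (f *: v)) (kd u).
  apply: kall_comp; rewrite kmap_scale -[_ *: _](subKr (kd z)).
  apply: kallB => //; have := kall_kdZ Zg Zu.
  by rewrite !linearB /= kd_kd subr0 linearZ.
have [|t ht Zt] := Rc _ _ _ hu Zdu; first by lia.
exists (w + f *: t).
  apply: kallD => //; first exact: addsub_hom.
  by apply: kallZ ht => v /(homM fd); rewrite subrK.
rewrite (_ : z - _ = (z - kd w - f *: u) + f *: (u - kd t)).
  apply: kallD => //; rewrite -kmap_scale.
  by apply: kall_map Zt.
by rewrite linearD linearZ /= scalerBr opprD !addrA subrK.
Qed.

Section MayerVietoris.
Variables (Z1 Z2 : 'rV[S]_b -> Prop) (rho sigma : int).
Hypotheses (g1 : gsub a Z1) (g2 : gsub a Z2) (sr : sigma < rho).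
Hypothesis R12 : RQ a (zsum Z1 Z2) sigma.

Lemma kall_zsum (u w : kosX) : kall Z2 w -> kall Z1 (u - w) -> kall (zsum Z1 Z2) u.
Proof.
elim: (X) u w => [|i s IH] u w /=; first by exists w.
by case=> ? ? [? ?]; split; [apply: (IH _ w.1) | apply: (IH _ w.2)].
Qed.

Lemma RQ_cap : RQ a Z1 rho -> RQ a Z2 rho -> RQ a (fun v => Z1 v /\ Z2 v) rho.
Proof.
move=> R1 R2 q z rq hz dz; have [a1 _ _] := g1; have [a2 _ _] := g2.
have [v1 h1 Zv1] : exists2 w : kosX, kall (rhom a (q - 1)) w & kall Z1 (z - kd w).
  by apply: R1 => //; apply: kall_imp dz => v [].
have [v2 h2 Zv2] : exists2 w : kosX, kall (rhom a (q - 1)) w & kall Z2 (z - kd w).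
  by apply: R2 => //; apply: kall_imp dz => v [].
have ah := @addsub_hom K m b a.
(* Two fillings of the same z differ by a cycle modulo Z1 + Z2. It has degree q - 1 >= rho > sigma:
   this is where the strict inequality enters. *)
have [|||w hw Zw] := R12 (q := q - 1) (z := v1 - v2); first by lia.
- exact: kallB.
- apply: (@kall_zsum _ (z - kd v2)) => //.
  rewrite linearB /= (_ : _ - _ - _ = - (z - kd v1)); first exact: kallN.
  by rewrite !opprB addrA subrK.
have hvw : kall (rhom a (q - 1)) (v1 - v2 - kd w).
  apply: kallB; [exact: ah | exact: kallB |].
  by have := hom_kd hw; rewrite subrK.
have [p [hp Z2p Z1p]] := zsum_split_hom g1 g2 hvw Zw.
exists (v2 + p); first exact: kallD.
rewrite linearD /= opprD addrA; apply: kall_and; last first.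
  by apply: kallB => //; apply: (kall_kdZ g2).
have -> : z - kd v2 - kd p = (z - kd v1) + kd (v1 - v2 - kd w - p).
  by rewrite !linearB /= kd_kd subr0 !addrA subrK.
by apply: kallD => //; apply: (kall_kdZ g1).
Qed.

(** A class modulo Z2 in degree rho dies modulo Z1 + Z2. Subtracting a boundary and an element of Z2
    thus brings its representative into Z1 without changing the class modulo Z2, and the result is a
    cycle modulo the intersection. *)
Lemma NQ_cap : NQ a Z2 rho -> NQ a (fun v => Z1 v /\ Z2 v) rho.
Proof.
move=> [z [hz dz nz]]; have [a1 _ _] := g1; have [a2 _ _] := g2.
have ah := @addsub_hom K m b a.
have [|w hw Zw] := R12 sr hz.
  by apply: (@kall_zsum _ (kd z)) => //; rewrite subrr; apply: kall0; case: a1.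
have hzw : kall (rhom a rho) (z - kd w).
  by apply: kallB => //; have := hom_kd hw; rewrite subrK.
have [p [hp Z2p Z1p]] := zsum_split_hom g1 g2 hzw Zw.
exists (z - kd w - p); split.
- exact: kallB.
- apply: kall_and; first exact: (kall_kdZ g1).
  rewrite !linearB /= kd_kd subr0; apply: kallB => //; exact: (kall_kdZ g2).
- move=> u Zu; have Z2u : kall Z2 (z - kd w - p - kd u) by apply: kall_imp Zu => v [].
  apply: (nz (w + u)).
  rewrite (_ : z - _ = (z - kd w - p - kd u) + p); first exact: kallD.
  by rewrite linearD /= opprD addrA [in RHS]addrAC subrK.
Qed.

End MayerVietoris.
End RegularityRules.

(** * Minimal resolutions *)

Section Syzygies.
Variables (K : fieldType) (m : nat).
Local Notation S := {mpoly K[m]}.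
Local Notation X := (enum 'I_m).

Definition graded_mx b b' (a : 'I_b -> nat) (a' : 'I_b' -> nat) (D : 'M[S]_(b', b)) :=
  forall j k, cz ((a' j)%:Z - (a k)%:Z) (D j k) = D j k.
Definition im_mx b b' (D : 'M[S]_(b', b)) (v : 'rV[S]_b) := exists w : 'rV[S]_b', v = w *m D.
Definition ker_mx b b' (D : 'M[S]_(b', b)) (v : 'rV[S]_b') := v *m D = 0.
Definition minimal_sub b (Z : 'rV[S]_b -> Prop) := forall v, Z v -> forall k, cz 0 (v 0 k) = 0.

(* Vanishing of the Koszul homology of the quotient by Z in exterior degree at least j. *)
Definition HV b (Z : 'rV[S]_b -> Prop) (j : nat) := forall z : kos 'rV[S]_b X,
  klv j z -> kall Z (kd z) -> exists2 w : kos 'rV[S]_b X, klv j.+1 w & kall Z (z - kd w).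

Section OneStep.
Variables (b b' : nat) (a : 'I_b -> nat) (a' : 'I_b' -> nat) (D : 'M[S]_(b', b)).
Variable Z : 'rV[S]_b -> Prop.
Hypotheses (Dg : graded_mx a a' D) (DZ : forall v, Z v <-> im_mx D v).

Lemma rcz_mulmx q (v : 'rV[S]_b') : rcz a q (v *m D) = rcz a' q v *m D.
Proof.
apply/rowP=> k; rewrite !mxE linear_sum /=; apply: eq_bigr => j _.
rewrite mxE [_ * D j k]mulrC [RHS]mulrC -(cz_mul _ _ (Dg j k)); congr cz.
by rewrite addrA subrK.
Qed.

Lemma gsub_ker : gsub a' (ker_mx D).
Proof.
split; first split.
- by rewrite /ker_mx mul0mx.
- by rewrite /ker_mx => u v hu hv; rewrite mulmxBl hu hv subr0.
- by rewrite /ker_mx => c v hv; rewrite -scalemxAl hv scaler0.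
- by rewrite /ker_mx => q v hv; rewrite -rcz_mulmx hv raddf0.
Qed.

Local Notation phi := (mulmxr D : {additive 'rV[S]_b' -> 'rV[S]_b}).

Lemma phi_kd s (z : kos 'rV[S]_b' s) : kmap phi (kd z) = kd (kmap phi z).
Proof. by apply: kmap_kd => i v _ /=; rewrite scalemxAl. Qed.

Lemma kall_ker s (z : kos 'rV[S]_b' s) : kall (ker_mx D) z <-> kmap phi z = 0.
Proof.
elim: s z => [|i s IH] z //=; case: z => u v /=; rewrite !IH.
by split=> [[-> ->]|[-> ->]].
Qed.

Lemma phi_hom s q (z : kos 'rV[S]_b' s) : kall (rhom a' q) z -> kall (rhom a q) (kmap phi z).
Proof. by apply: kall_map => v /= hv; rewrite /rhom rcz_mulmx hv. Qed.

Lemma kall_phi s (z : kos 'rV[S]_b' s) : kall Z (kmap phi z).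
Proof.
have : kall (fun _ => True) z by elim: s z => [|i s IH] z /=.
by apply: kall_map => v _; apply/DZ; exists v.
Qed.

Lemma phi_lift s q (u : kos 'rV[S]_b s) : kall (rhom a q) u -> kall Z u ->
  exists2 t, kall (rhom a' q) t & u = kmap phi t.
Proof.
move=> hu Zu; have [|||t [_ ht ->]] := @kall_split_lv _ _ _ _ phi
    (fun v => rhom a q v /\ Z v) (rhom a' q) _ _ s 0 u (klv0 u).
- by case: (@addsub_hom K m b' a' q).
- move=> v [hv /DZ[w vw]]; exists (rcz a' q w); first exact: hom_rcz.
  by rewrite /= -rcz_mulmx -vw hv.
- exact: kall_and.
- by exists t.
Qed.

(** Dimension shift: the quotient by [ker_mx D] is Z, and the free module is acyclic in the degrees
    concerned, so a cycle modulo the kernel in degree q corresponds to a cycle modulo Z of exterior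
    degree one higher and coefficient degree q - 1. *)
Lemma syz_RQ rho : (forall k, (a k)%:Z <= rho) -> RQ a Z rho -> RQ a' (ker_mx D) (rho + 1).
Proof.
move=> ar R q z rq hz /kall_ker; rewrite phi_kd => dy.
have hy := phi_hom hz.
have yE : kmap phi z = kd (kh (kmap phi z)).
  by apply: (koszul_exact_hom dy hy) => k; have := ar k; lia.
set w := kh _ in yE; have hw : kall (rhom a (q - 1)) w by apply: kh_hom.
have Zw : kall Z (kd w) by rewrite -yE; apply: kall_phi.
have [|u hu Zu] := R _ w _ hw Zw; first by lia.
have huw : kall (rhom a (q - 1)) (w - kd u).
  by apply: kallB => //; [exact: addsub_hom | have := hom_kd hu; rewrite subrK].
have [t ht tE] := phi_lift huw Zu.
exists t => //; apply/kall_ker.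
by rewrite raddfB /= phi_kd -tE yE linearB /= kd_kd subr0 subrr.
Qed.

(** The same shift without degrees: constant terms are now excluded by minimality of Z. *)
Lemma syz_HV (j : nat) : minimal_sub Z -> HV Z j.+1 -> HV (ker_mx D) j.
Proof.
move=> Zmin H z lz /kall_ker; rewrite phi_kd => dy.
have yE : kmap phi z = kd (kh (kmap phi z)).
  by apply: koszul_exact => // k; apply: Zmin; apply: kall_bot; apply: kall_phi.
set w := kh _ in yE; have lw : klv j.+1 w by apply/kh_lv/klv_map.
have Zw : kall Z (kd w) by rewrite -yE; apply: kall_phi.
have [u lu Zu] := H w lw Zw.
have luw : klv j.+1 (w - kd u) by apply: klvD => //; apply/klvN/klv_kd.
have [|v /DZ[x ->]|t [lt _ tE]] := @kall_split_lv _ _ _ _ phi Z (fun _ => True) _ _ _ _ _ luw Zu.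
- by [].
- by exists x.
exists t => //; apply/kall_ker.
by rewrite raddfB /= phi_kd -tE yE linearB /= kd_kd subr0 subrr.
Qed.

(** The converse shift: d z lies in Z and lifts to a cycle modulo the kernel; filling that cycle by
    w turns z - [phi] w into a genuine cycle of the free module, whose degree exceeds all generator
    degrees. *)
Lemma syz_RQ_rev rho : (forall k, (a k)%:Z <= rho) -> RQ a' (ker_mx D) (rho + 1) -> RQ a Z rho.
Proof.
move=> ar R q z rq hz Zdz.
have [y hy yE] := phi_lift (hom_kd hz) Zdz.
have dy : kall (ker_mx D) (kd y) by apply/kall_ker; rewrite phi_kd -yE kd_kd.
have [|w hw Zw] := R _ y _ hy dy; first by lia.
have /kall_ker := Zw; rewrite raddfB /= phi_kd -yE => /eqP; rewrite subr_eq0 => /eqP dzE.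
have hw' : kall (rhom a q) (kmap phi w) by apply: phi_hom; rewrite -[q](addrK 1).
have hzw : kall (rhom a q) (z - kmap phi w) by apply: kallB => //; exact: addsub_hom.
have dzw : kd (z - kmap phi w) = 0 by rewrite linearB /= dzE subrr.
have zE : z - kmap phi w = kd (kh (z - kmap phi w)).
  by apply: (koszul_exact_hom dzw hzw) => k; have := ar k; lia.
exists (kh (z - kmap phi w)); first exact: kh_hom.
rewrite -zE opprB addrC subrK; exact: kall_phi.
Qed.

End OneStep.

Lemma kall_true (V : lmodType S) s (u : kos V s) : kall (fun _ => True) u.
Proof. by elim: s u => [|i s IH] u /=. Qed.

Lemma kbot_kd_const b s (w : kos 'rV[S]_b s) k : cz 0 (kbot (kd w) 0 k) = 0.
Proof.
suff /kall_bot : kall (fun v : 'rV[S]_b => forall k, cz 0 (v 0 k) = 0) (kd w) by apply.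
apply: kall_kd (kall_true w).
  split=> [l|u v hu hv l]; first by rewrite mxE linear0.
  by rewrite !mxE linearB /= hu hv subr0.
move=> i v _ l; rewrite mxE -[0](addNr 1) mulrC mulrC cz_mul ?cz_var //.
by rewrite cz_neg ?mulr0.
Qed.

(** Nakayama: a basis vector would be a bottom cycle, yet Z and all boundaries have bottom
    components without constant term. *)
Lemma HV_rank0 b a (Z : 'rV[S]_b -> Prop) : gsub a Z -> minimal_sub Z -> HV Z 0 -> b = 0%N.
Proof.
case: b a Z => // b a Z [[Z0 _] _ _] Zmin H.
pose v : 'rV[S]_b.+1 := delta_mx 0 0.
have dk : kd (kin X v) = 0.
  by elim: (X) => [|i s IH] //=; rewrite IH scaler0 addr0 linear0 oppr0.
have [|w _ Zw] := H _ (klv0 (kin X v)); first by rewrite dk; apply: kall0.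
have := Zmin _ (kall_bot Zw) 0; rewrite kbot_sub !mxE linearB /= kbot_kd_const subr0.
have -> : kbot (kin X v) = v by elim: (X).
by rewrite mxE !eqxx cz0E mcoeff1 eqxx => /eqP; rewrite oner_eq0.
Qed.

End Syzygies.

Lemma ex_last (P : nat -> Prop) N : P 0%N -> (forall n, P n -> (n <= N)%N) ->
  exists2 n, P n & ~ P n.+1.
Proof.
move=> P0 PN; apply: NNPP => nex.
have PS n : P n -> P n.+1 by move=> Pn; apply: NNPP => nP; apply: nex; exists n.
have Pall n : P n by elim: n => // n; apply: PS.
by have := PN _ (Pall N.+1); rewrite ltnn.
Qed.

Lemma ex_first (P : nat -> Prop) n : P n -> exists2 k, P k & forall j, (j < k)%N -> ~ P j.
Proof.
elim/ltn_ind: n => n IH Pn.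
have [[j jn Pj]|nex] := classic (exists2 j, (j < n)%N & P j); first exact: IH jn Pj.
by exists n => // j jn Pj; apply: nex; exists j.
Qed.

(** * Finite and minimal homogeneous generating families *)

Section MinimalGenerators.
Variables (K : fieldType) (m b : nat).
Local Notation S := {mpoly K[m]}.
Local Notation X := (enum 'I_m).

Section FiniteSpan.
Variables (P : 'rV[S]_b -> Prop) (N : nat).
Hypotheses (P0 : P 0) (PD : forall u v, P u -> P v -> P (u + v)).
Hypothesis PZ : forall (c : K) v, P v -> P (c%:MP *: v).
Hypothesis PN : forall v, P v -> forall k u, (N <= mdeg u)%N -> (v 0 k)@_u = 0.

Local Notation T := ('I_b * 'X_{1..m < N})%type.
Definition coord_mx n (u : 'M[S]_(n, b)) : 'M[K]_(n, #|{: T}|) :=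
  \matrix_(j, t) (u j (enum_val t : T).1)@_(bmnm (enum_val t : T).2).

Lemma coord_mx_comb n (c : 'rV[K]_n) (u : 'M[S]_(n, b)) :
  coord_mx (map_mx (@mpolyC m K) c *m u) = c *m coord_mx u.
Proof.
apply/matrixP=> j t; rewrite !mxE linear_sum /=; apply: eq_bigr => i _.
by rewrite !mxE mcoeffCM ord1.
Qed.

Lemma coord_mx_inj (v w : 'rV[S]_b) : P v -> P w -> coord_mx v = coord_mx w -> v = w.
Proof.
move=> Pv Pw vw; apply/rowP=> k; apply/mpolyP=> u.
have [uN|Nu] := ltnP (mdeg u) N; last by rewrite !PN.
have /matrixP/(_ 0 (enum_rank (k, BMultinom uN))) := vw.
by rewrite !mxE enum_rankK.
Qed.

(** Rows of bounded degree embed by their coefficients into a finite-dimensional space over K; a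
    longest linearly independent family in [P] spans it. *)
Lemma fin_span : exists n (u : 'M[S]_(n, b)), (forall j, P (row j u)) /\
  forall v, P v -> exists c : 'rV[K]_n, v = map_mx (@mpolyC m K) c *m u.
Proof.
pose Q n := exists u : 'M[S]_(n, b), (forall j, P (row j u)) /\ row_free (coord_mx u).
have [||n [u [Pu uf]] nQ] := @ex_last Q #|{: T}|.
- by exists 0; split=> [[]//|]; rewrite /row_free flatmx0 mxrank0.
- by move=> n [u [_ /eqP <-]]; apply: rank_leq_col.
exists n, u; split=> // v Pv.
have Pc (c : 'rV[K]_n) : P (map_mx (@mpolyC m K) c *m u).
  rewrite mulmx_sum_row; elim/big_ind: _ => // j _.
  by rewrite mxE; apply: PZ.
suff /submxP[c cE] : (coord_mx v <= coord_mx u)%MS.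
  by exists c; apply: coord_mx_inj; rewrite ?coord_mx_comb.
apply/negPn/negP=> nvu; apply: nQ; exists (col_mx v u : 'M_(1 + n, b)); split.
  move=> j; case: (@split_ordP 1 n j) => k ->.
    by rewrite (_ : row _ _ = v) //; apply/rowP=> l; rewrite !mxE (unsplitK (inl k)) ord1.
  by rewrite (_ : row _ _ = row k u) //; apply/rowP=> l; rewrite !mxE (unsplitK (inr k)).
have -> : coord_mx (col_mx v u : 'M_(1 + n, b)) = col_mx (coord_mx v) (coord_mx u).
  apply/matrixP=> j t; case: (@split_ordP 1 n j) => k ->.
    by rewrite col_mxEu !mxE (unsplitK (inl k)).
  by rewrite col_mxEd !mxE (unsplitK (inr k)).
have lt_n : (n < \rank (col_mx (coord_mx v) (coord_mx u)))%N.
  rewrite -addsmxE -{1}(eqP uf); apply: rank_ltmx.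
  by rewrite ltmxE addsmxSr addsmx_sub submx_refl andbT.
by rewrite /row_free eqn_leq rank_leq_row.
Qed.

End FiniteSpan.

Variables (a : 'I_b -> nat) (Z : 'rV[S]_b -> Prop).
Hypothesis Zg : gsub a Z.

Definition gens D n (e : 'I_n -> nat) (d : 'M[S]_(n, b)) :=
  [/\ graded_mx a e d, forall j, Z (row j d), forall j, (e j <= D)%N & forall v, Z v -> im_mx d v].

Lemma rhom_row n (e : 'I_n -> nat) (d : 'M[S]_(n, b)) :
  (forall j, rhom a (e j)%:Z (row j d)) <-> graded_mx a e d.
Proof.
split=> h j.
  by move=> k; have /rowP/(_ k) := h j; rewrite !mxE.
by apply/rowP=> k; rewrite !mxE h.
Qed.

Lemma addsub_im n (d : 'M[S]_(n, b)) : addsub (im_mx d).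
Proof.
split; first by exists 0; rewrite mul0mx.
by move=> u v [x ->] [y ->]; exists (x - y); rewrite mulmxBl.
Qed.

(** In exterior degree 0, v = d w, and w is a cycle modulo Z of degree q - 1 > rho, hence w = d u
    modulo Z. So v = d (w - d u) is a combination of elements of Z of degree q - 1 with variables as
    coefficients: Z has no new generators above degree rho + 1. *)
Lemma RQ_generated (G : 'rV[S]_b -> Prop) (rho q : nat) (v : 'rV[S]_b) :
  addsub G -> (forall (c : S) u, G u -> G (c *: u)) ->
  (forall k, (a k <= rho)%N) -> RQ a Z rho%:Z -> (rho.+1 < q)%N ->
  (forall u, rhom a (q%:Z - 1) u -> Z u -> G u) -> rhom a q%:Z v -> Z v -> G v.
Proof.
move=> Ga Gm ar R rq IH hv Zv; have [Za _ _] := Zg.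
have dv : kd (kin X v) = 0.
  by elim: (X) => [|i s IHs] //=; rewrite IHs scaler0 addr0 linear0 oppr0.
have hkv : kall (rhom a q) (kin X v) by apply: kall_in => //; case: (@addsub_hom K m b a q).
have vE : kin X v = kd (kh (kin X v)).
  by apply: (koszul_exact_hom dv hkv) => k; have := ar k; lia.
set w := kh _ in vE; have hw : kall (rhom a (q%:Z - 1)) w by apply: kh_hom.
have Zw : kall Z (kd w) by rewrite -vE; apply: kall_in => //; case: Za.
have [|u hu Zu] := R _ w _ hw Zw; first by lia.
have hwu : kall (rhom a (q%:Z - 1)) (w - kd u).
  by apply: kallB => //; [exact: addsub_hom | have := hom_kd hu; rewrite subrK].
have Gwu : kall G (w - kd u) by apply: kall_imp (kall_and hwu Zu) => x []; apply: IH.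
have -> : v = kbot (kd (w - kd u)).
  by rewrite linearB /= kd_kd subr0 -vE; elim: (X).
by apply: kall_bot; apply: (kall_kd Ga _ Gwu) => i x; apply: Gm.
Qed.

Lemma gens_exist (rho : nat) : (forall k, (a k <= rho)%N) -> RQ a Z rho%:Z ->
  exists n (e : 'I_n -> nat) d, gens rho.+1 e d.
Proof.
move=> ar R; have [[Z0 ZB] Zm Zc] := Zg.
have ZD u v : Z u -> Z v -> Z (u + v).
  by move=> Zu Zv; rewrite -[v]opprK; apply: (ZB) => //; rewrite -sub0r; apply: ZB.
pose P v := Z v /\ v = \sum_(q < rho.+2) rcz a q%:Z v.
have [||||n [u [Pu uP]]] := @fin_span P rho.+2.
- by split=> //; rewrite big1 // => q _; rewrite raddf0.
- move=> v w [Zv vE] [Zw wE]; split; first exact: ZD.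
  by rewrite {1}vE {1}wE -big_split; apply: eq_bigr => q _; rewrite raddfD.
- move=> c v [Zv vE]; split; first exact: Zm.
  rewrite {1}vE scaler_sumr; apply: eq_bigr => q _.
  by rewrite (@rczM' _ _ _ a _ 0) ?subr0 // cz0E mcoeffC eqxx mulr1.
- move=> v [_ ->] k t Nt; rewrite summxE linear_sum big1 // => q _.
  by rewrite /= !mxE coef_cz; case: eqP => //; have := ltn_ord q; lia.
(* The spanning rows need not be homogeneous; their components of degree at most rho + 1 serve as
   generators. *)
pose T := ('I_n * 'I_rho.+2)%type.
pose e (t : 'I_#|{: T}|) : nat := (enum_val t).2.
pose d : 'M[S]_(#|{: T}|, b) := \matrix_t rcz a (e t)%:Z (row (enum_val t).1 u).
have dP v : P v -> im_mx d v.
  move=> Pv; have [c ->] := uP v Pv.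
  exists (\row_t (c 0 (enum_val t).1)%:MP).
  rewrite !mulmx_sum_row (reindex (@enum_rank {: T})) /=; last first.
    by apply: onW_bij; apply: enum_rank_bij.
  rewrite (eq_bigr (fun t : T => (c 0 t.1)%:MP *: rcz a t.2%:Z (row t.1 u))); last first.
    by move=> t _; rewrite mxE rowK /e enum_rankK.
  rewrite -(pair_bigA _ (fun (i : 'I_n) (q : 'I_rho.+2) => (c 0 i)%:MP *: rcz a q%:Z (row i u))) /=.
  by apply: eq_bigr => i _; rewrite mxE -scaler_sumr -(proj2 (Pu i)).
have hom_im q v : rhom a q%:Z v -> Z v -> im_mx d v.
  elim/ltn_ind: q v => q IH v hv Zv.
  have [qr|rq] := leqP q rho.+1.
    apply: dP; split=> //; rewrite (bigD1 (Ordinal (qr : q < rho.+2)%N)) //= hv big1 ?addr0 // => t tq.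
    apply: (hom_neq hv); apply: contraNneq tq => tq; apply/eqP/val_inj => /=; lia.
  apply: (RQ_generated (rho := rho) (q := q)) => //; first exact: addsub_im.
    by move=> c w [x ->]; exists (c *: x); rewrite scalemxAl.
  move=> w; have -> : q%:Z - 1 = q.-1%:Z by lia.
  by apply: IH; lia.
exists #|{: T}|, e, d; split.
- by apply/rhom_row => j; rewrite rowK; apply: hom_rcz.
- by move=> j; rewrite rowK; apply: Zc; case: (Pu (enum_val j).1).
- by move=> j; rewrite -ltnS; apply: ltn_ord.
- move=> v Zv; have [N ->] := row_sum a v.
  have [d0 dB] := addsub_im d.
  have dD x y : im_mx d x -> im_mx d y -> im_mx d (x + y).
    by move=> [x' ->] [y' ->]; exists (x' + y'); rewrite mulmxDl.
  elim/big_ind: _ => // q _; apply: (hom_im q); [exact: hom_rcz | exact: Zc].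
Qed.

Lemma gens_min (rho : nat) : (forall k, (a k <= rho)%N) -> RQ a Z rho%:Z ->
  exists n (e : 'I_n -> nat) d, gens rho.+1 e d /\ minimal_sub (ker_mx d).
Proof.
move=> ar R; have [n0 [e0 [d0 g0]]] := gens_exist ar R.
have [n [e [d g]] nmin] := ex_first (P := fun n => exists (e : 'I_n -> nat) d, gens rho.+1 e d)
   (ex_intro _ e0 (ex_intro _ d0 g0)).
exists n, e, d; split=> //.
case: n e d g nmin => [|n] e d [gd Zd le_e imd] nmin v dv i; first by case: i.
apply: NNPP => vi.
(* Passing to the component of degree [e i] makes the coordinate at i equal to the constant c
   instead of merely having constant term c; the i-th generator is then redundant, against the
   choice of n. *)
pose u := rcz e (e i) v.
have du : u *m d = 0 by rewrite /u -(rcz_mulmx gd) dv raddf0.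
pose c := (v 0 i)@_0%MM.
have ui : u 0 i = c%:MP by rewrite mxE subrr cz0E.
have c0 : c != 0 by apply/eqP => c0; apply: vi; rewrite cz0E -/c c0.
apply: (nmin n) => //; exists (e \o lift i), (row' i d); split=> [j k|j|j|w Zw].
- by rewrite mxE /= gd.
- by rewrite (_ : row _ _ = row (lift i j) d) //; apply/rowP=> k; rewrite !mxE.
- exact: le_e.
have [x xE] := imd _ Zw.
pose y := x - (x 0 i * (c^-1)%:MP) *: u.
have yd : y *m d = w by rewrite mulmxBl -scalemxAl du scaler0 subr0 xE.
have yi : y 0 i = 0.
  have -> : y 0 i = x 0 i - x 0 i * (c^-1)%:MP * u 0 i by rewrite !mxE.
  by rewrite ui -mulrA -mpolyCM mulVf // mulr1 subrr.
exists (col' i y); rewrite -yd; apply/rowP=> k; rewrite !mxE.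
rewrite (bigD1_ord i) //= yi mul0r add0r.
by apply: eq_bigr => j _; rewrite !mxE.
Qed.

End MinimalGenerators.

(** * Assembling the minimal resolution and reading off its regularity *)

Section Resolution.
Variables (K : fieldType) (m : nat).
Local Notation S := {mpoly K[m]}.

Record stage := Stage { sb : nat; sa : 'I_sb -> nat; sZ : 'rV[S]_sb -> Prop }.

Arguments sa : clear implicits.
Arguments sZ : clear implicits.

Section Sequence.
Variable r : nat.

(** Each syzygy step raises the degree bounds by one and lowers by one the exterior degree from
    which homology vanishes; for i > m all of it vanishes and the module has rank 0. *)
Definition stage_ok (i : nat) (s : stage) :=
  [/\ gsub (sa s) (sZ s), minimal_sub (sZ s), forall k, (sa s k <= r + i)%N,
      RQ (sa s) (sZ s) (r + i)%:Z & forall j, (m < i + j)%N -> HV (sZ s) j].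

Definition stage_step (i : nat) (s s' : stage) (d : 'M[S]_(sb s', sb s)) :=
  [/\ stage_ok i.+1 s', graded_mx (sa s) (sa s') d,
      forall v, sZ s v <-> im_mx d v & forall v, sZ s' v <-> ker_mx d v].

Lemma stage_next i s : stage_ok i s -> exists s' d, @stage_step i s s' d.
Proof.
case=> sg smin sr sR sH.
have [n [e [d [[gd Zd le_e imd] kmin]]]] := gens_min sg sr sR.
have dZ v : sZ s v <-> im_mx d v.
  split; [exact: imd | case=> w ->]; rewrite mulmx_sum_row.
  have [[Z0 ZB] Zm _] := sg; elim/big_ind: _ => // [x y Zx Zy|j _]; last exact: Zm.
  by rewrite -[y]opprK; apply: (ZB) => //; rewrite -sub0r; apply: ZB.
exists (Stage e (ker_mx d)), d; split=> //; split=> //=.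
- exact: gsub_ker gd.
- by move=> k; rewrite addnS; apply: le_e.
- rewrite addnS (_ : (r + i).+1%:Z = (r + i)%:Z + 1); last by lia.
  by apply: syz_RQ gd dZ _ _ sR => k; rewrite lez_nat.
- by move=> j mj; apply: (syz_HV dZ smin); apply: sH; lia.
Qed.

(** Separating stage 0 keeps it convertible to [s0], so that its rank is 1 by computation, as
    [res_rank] demands. *)
Definition stages (s0 : stage) (f : nat -> stage) (i : nat) := if i is i'.+1 then f i' else s0.

Lemma stage_seq s0 : stage_ok 0 s0 ->
  exists f (d : forall i, 'M[S]_(sb (stages s0 f i.+1), sb (stages s0 f i))),
  forall i, stage_step i (d i).
Proof.
move=> ok0.
have next i (s : {s | stage_ok i s}) :
    {t : {s' : stage & 'M[S]_(sb s', sb (sval s))} | stage_step i (projT2 t)}.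
  apply: constructive_indefinite_description.
  by have [s' [d sd]] := stage_next (svalP s); exists (existT _ s' d).
pose step i s : {s | stage_ok i.+1 s} :=
  exist _ (projT1 (sval (next i s))) (let: And4 h _ _ _ := svalP (next i s) in h).
pose st := fix st i : {s | stage_ok i s} := if i is i'.+1 then step i' (st i') else exist _ s0 ok0.
exists (fun i => sval (st i.+1)).
exists (fun i => match i return 'M[S]_(sb (stages s0 (fun i => sval (st i.+1)) i.+1),
     sb (stages s0 (fun i => sval (st i.+1)) i)) with
  | 0 => projT2 (sval (next 0%N (st 0%N)))
  | i'.+1 => projT2 (sval (next i'.+1 (st i'.+1))) end).
by case=> [|i]; [exact: svalP (next 0%N (st 0%N)) | exact: svalP (next i.+1 (st i.+1))].
Qed.

End Sequence.

(** When [a' j <= a k] the entry has degree at most 0: negative degree makes it zero, and a constant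
    is excluded by minimality. *)
Lemma graded_minimal (b b' : nat) (a : 'I_b -> nat) (a' : 'I_b' -> nat) (d : 'M[S]_(b', b)) j k :
  graded_mx a a' d -> minimal_sub (im_mx d) ->
  d j k = 0 \/ (a k < a' j)%N /\ homog_of (a' j - a k) (d j k).
Proof.
move=> gd dmin; have [lt_a|le_a] := ltnP (a k) (a' j).
  right; split=> //; apply: cz_homog.
  by rewrite -subzn 1?ltnW // gd.
left; have := dmin (row j d) _ k; rewrite mxE => <-; last first.
  by exists (delta_mx 0 j); rewrite rowE.
rewrite -[LHS](gd j k) -[in RHS](gd j k) cz_id.
case: eqP => [<-//|ne]; first by rewrite cz_neg //; lia.
Qed.

Lemma regularity_quotI (gs : seq S) (r : nat) (Z : 'rV[S]_1 -> Prop) (a0 := fun _ : 'I_1 => 0%N) :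
  (forall v, Z v <-> in_ideal gs (v 0 0)) -> (0 < r)%N ->
  gsub a0 Z -> minimal_sub Z -> RQ a0 Z r -> NQ a0 Z r -> regularity_quot gs r.
Proof.
move=> ZE r0 Zg Zmin R N.
pose s0 := Stage a0 Z.
(* The vanishing at stage 0 concerns exterior degrees above the number of variables, where the
   complex is zero. *)
have ok0 : stage_ok r 0 s0.
  split=> //; rewrite ?addn0 //= => j mj z lz _; exists 0; first exact: klv_zero.
  rewrite (klv_big _ lz) ?size_enum_ord // linear0 subr0.
  by apply: kall0; case: Zg => [[]].
have [f [D Dok]] := stage_seq ok0.
have stok i : stage_ok r i (stages s0 f i).
  by case: i => [//|i]; case: (Dok i).
pose b i := sb (stages s0 f i).
pose a i : 'I_(res_rank b i) -> nat :=
  match i return 'I_(res_rank b i) -> nat with 0 => a0 | i'.+1 => sa (f i') end.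
pose d i : 'M[S]_(res_rank b i.+1, res_rank b i) :=
  match i return 'M[S]_(res_rank b i.+1, res_rank b i) with 0 => D 0%N | i'.+1 => D i'.+1 end.
have b0 i : (m < i)%N -> b i = 0%N.
  move=> mi; have [sg smin _ _ sH] := stok i.
  by apply: (HV_rank0 sg smin); apply: sH; rewrite addn0.
have le_a i j : (a i j <= r + i)%N.
  by case: i j => [|i] j //=; case: (stok i.+1) => _ _ le _ _; apply: le.
exists m, b, a, d; split.
  split=> //.
  - move=> i j k; case: i j k => [|i] j k.
      have [_ gd im _] := Dok 0%N; apply: graded_minimal gd _.
      by move=> v /im; apply: Zmin.
    have [_ gd im _] := Dok i.+1; apply: graded_minimal gd _.
    by have [_ smin _ _ _] := stok i.+1; move=> v /im; apply: smin.
  - split; [|split].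
    + move=> g; have [_ _ im _] := Dok 0%N; have := ZE (const_mx g); rewrite mxE => <-.
      split=> [/im[v vE]|[v vE]]; first by exists v; rewrite -vE mxE.
      by apply/im; exists v; apply/rowP=> k; rewrite mxE ord1 -vE.
    + move=> i; apply/row_matrixP=> j; rewrite row_mul row0.
      case: i j => [|i] j.
        by have [_ _ _ /(_ (row j (d 1%N)))[h _]] := Dok 0%N; apply: h; have [_ _ im _] := Dok 1%N;
           apply/im; exists (delta_mx 0 j); rewrite rowE.
      by have [_ _ _ /(_ (row j (d i.+2)))[h _]] := Dok i.+1; apply: h; have [_ _ im _] := Dok i.+2;
           apply/im; exists (delta_mx 0 j); rewrite rowE.
    + case=> [|i] v dv.
        by have [_ _ _ /(_ v)[_ h]] := Dok 0%N; have [_ _ im _] := Dok 1%N; apply/im/h.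
      by have [_ _ _ /(_ v)[_ h]] := Dok i.+1; have [_ _ im _] := Dok i.+2; apply/im/h.
apply/eqP; rewrite eqn_leq; apply/andP; split.
  by apply/bigmax_leqP => i _; apply/bigmax_leqP => j _; rewrite leq_subLR addnC le_a.
rewrite leqNgt; apply/negP=> lt_r.
(* If [r] were not attained, all twists would obey the bounds for r - 1; past step m there are no
   generators. *)
have lt_a i k : (sa (stages s0 f i) k <= r.-1 + i)%N.
  have [mi|im] := ltnP m i; first by have := ltn_ord k;
    move: (nat_of_ord k) => t; rewrite (b0 i mi : sb _ = _).
  have aik (j : 'I_(res_rank b i)) : (a i j - i < r)%N.
    apply: leq_trans lt_r; rewrite ltnS.
    apply: leq_trans (leq_bigmax (F := fun j : 'I_(res_rank b i) => (a i j - i)%N) j) _.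
    exact: (leq_bigmax (F := fun i : 'I_m.+1 => \max_(j < res_rank b i) (a i j - i)%N)
      (Ordinal (im : (i < m.+1)%N))).
  by case: i k {im} aik => [|i] k /(_ k) /=; lia.
(* Descending induction on i from the zero module at stage m + 1; stage 0 will contradict the class
   given by [N]. *)
have RR n i : (i + n)%N = m.+1 -> RQ (sa (stages s0 f i)) (sZ (stages s0 f i)) (r.-1 + i)%:Z.
  elim: n i => [|n IH] i iE.
    have [[[Z0 _] _ _] _ _ _ _] := stok i.
    move=> q z _ _ _; exists 0; first by apply: kall0; case: (@addsub_hom K m _ (sa (stages s0 f i)) (q - 1)).
    apply: (kall_imp _ (kall_true _)) => v _.
    have bi : sb (stages s0 f i) = 0%N by apply: b0; lia.
    rewrite (_ : v = 0) //; apply/rowP=> k; exfalso.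
    by have := ltn_ord k; move: (nat_of_ord k) => t; rewrite bi.
  have [_ gd im ker] := Dok i.
  apply: (syz_RQ_rev gd im) => [k|]; first by rewrite lez_nat.
  rewrite (_ : _ + 1 = (r.-1 + i.+1)%:Z); last by lia.
  by apply: (RQ_ext ker); apply: IH; lia.
have [z [hz dz nz]] := N.
have [|w _ Zw] := RR m.+1 0%N erefl r%:Z z _ hz dz; first by rewrite addn0; lia.
exact: nz Zw.
Qed.

End Resolution.

(** * Ideals generated by polynomials *)

Section Ideals.
Variables (K : fieldType) (m : nat).
Local Notation S := {mpoly K[m]}.
Implicit Types (T : S -> Prop) (p q f g c : S) (i : 'I_m).

(** An ideal given by a predicate on generators: unions and additions of generators are
    disjunctions, and membership is proved by induction on the combination. *)
Inductive spn T : S -> Prop :=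
| spn0 : spn T 0
| spn_cons c g p : T g -> spn T p -> spn T (c * g + p).

Lemma spn_gen T g : T g -> spn T g.
Proof. by move=> Tg; rewrite -[g]mul1r -[1 * g]addr0; apply: spn_cons => //; exact: spn0. Qed.

Lemma spnD T p q : spn T p -> spn T q -> spn T (p + q).
Proof. by elim=> [|c g p' Tg _ IH]; rewrite ?add0r // -addrA => /IH; apply: spn_cons. Qed.

Lemma spnM T c p : spn T p -> spn T (c * p).
Proof.
elim=> [|d g p' Tg _ IH]; first by rewrite mulr0; exact: spn0.
by rewrite mulrDr mulrA; apply: spn_cons.
Qed.

Lemma spnB T p q : spn T p -> spn T q -> spn T (p - q).
Proof. by move=> Tp Tq; rewrite -mulN1r; apply/spnD/spnM. Qed.

Lemma spn_mono T T' p : (forall g, T g -> spn T' g) -> spn T p -> spn T' p.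
Proof. by move=> TT; elim=> [|c g p' /TT Tg _ IH]; [exact: spn0 | apply/spnD/IH/spnM]. Qed.

Lemma in_ideal_spn (gs : seq S) p : in_ideal gs p <-> spn (fun g => g \in gs) p.
Proof.
split=> [[c ->]|].
  elim/big_ind: _ => [|x y|i _]; [exact: spn0 | exact: spnD |].
  by apply/spnM/spn_gen/mem_nth.
elim=> [|c g q gin _ [cs ->]].
  by exists [::]; rewrite big1 // => i _; rewrite nth_nil mul0r.
pose j := index g gs; have jl : (j < size gs)%N by rewrite index_mem.
exists (mkseq (fun k => (if k == j then c else 0) + cs`_k) (size gs)).
rewrite [RHS](eq_bigr (fun k : 'I__ => (if val k == j then c * gs`_k else 0) + cs`_k * gs`_k)).
  rewrite big_split /= -big_mkcond; congr (_ + _).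
  by rewrite (big_pred1 (Ordinal jl)) /= ?nth_index // => k; rewrite -val_eqE.
by move=> k _; rewrite nth_mkseq // mulrDl; case: ifP; rewrite ?mul0r.
Qed.

Definition homogeneous T := forall g, T g -> exists d : int, cz d g = g.

Lemma spn_cz T (q : int) p : homogeneous T -> spn T p -> spn T (cz q p).
Proof.
move=> hT; elim=> [|c g r Tg _ IH]; first by rewrite linear0; exact: spn0.
have [d gd] := hT _ Tg; have := cz_mul (q - d) c gd.
by rewrite subrK linearD /= mulrC => ->; rewrite mulrC; apply: spn_cons.
Qed.

Definition var_free i T := forall g, T g -> Ev i g = g.

Lemma spn_Ev i T p : var_free i T -> spn T p -> spn T (Ev i p).
Proof.
move=> fT; elim=> [|c g r Tg _ IH]; first by rewrite linear0; exact: spn0.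
by rewrite linearD /= Ev_mul (fT _ Tg); apply: spn_cons.
Qed.

Lemma spn_Dv i T p : var_free i T -> spn T p -> spn T (Dv i p).
Proof.
move=> fT; elim=> [|c g r Tg _ IH]; first by rewrite linear0; exact: spn0.
rewrite linearD /= mulrC Dv_mul; last exact: fT.
by rewrite mulrC; apply: spn_cons.
Qed.

Definition nzd T f := forall p, spn T (f * p) -> spn T p.

(** Division by X_i is linear over polynomials without X_i, so it preserves the ideal. *)
Lemma free_nzd i T : var_free i T -> nzd T 'X_i.
Proof. by move=> fT p /(spn_Dv fT); rewrite Dv_mulX. Qed.

Definition addg T f g := T g \/ g = f.

Lemma spn_addg T f p : spn (addg T f) p <-> exists c, spn T (p - c * f).
Proof.
split=> [|[c Tp]].
  elim=> [|c g q Tg _ [d Tq]]; first by exists 0; rewrite mul0r subr0; exact: spn0.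
  case: Tg => [Tg|->]; first by exists d; rewrite -addrA; apply: spn_cons.
  by exists (c + d); rewrite mulrDl opprD addrACA subrr add0r.
rewrite -[p](subrK (c * f)); apply: spnD; last by apply/spnM/spn_gen; right.
by apply: spn_mono Tp => g Tg; apply: spn_gen; left.
Qed.

Lemma homogeneous_addg T f (d : int) : homogeneous T -> cz d f = f -> homogeneous (addg T f).
Proof. by move=> hT fd g [/hT//|->]; exists d. Qed.

Lemma free_addg T f i : var_free i T -> Ev i f = f -> var_free i (addg T f).
Proof. by move=> hT fi g [/hT|->]. Qed.

Definition row_of (I : S -> Prop) (v : 'rV[S]_1) := I (v 0 0).
Local Notation a0 := (fun _ : 'I_1 => 0%N).

Definition RU (I : S -> Prop) (rho : int) := RQ a0 (row_of I) rho.
Definition NU (I : S -> Prop) (rho : int) := NQ a0 (row_of I) rho.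

Lemma RU_ext (I I' : S -> Prop) rho : (forall p, I p <-> I' p) -> RU I rho -> RU I' rho.
Proof. by move=> II'; apply: RQ_ext => v; apply: II'. Qed.
Lemma NU_ext (I I' : S -> Prop) rho : (forall p, I p <-> I' p) -> NU I rho -> NU I' rho.
Proof. by move=> II'; apply: NQ_ext => v; apply: II'. Qed.
Lemma RU_le (I : S -> Prop) rho rho' : rho <= rho' -> RU I rho -> RU I rho'.
Proof. exact: RQ_le. Qed.

Lemma gsub_spn T : homogeneous T -> gsub a0 (row_of (spn T)).
Proof.
move=> hT; rewrite /row_of; split; first split.
- by rewrite mxE; exact: spn0.
- by move=> u v; rewrite !mxE; apply: spnB.
- by move=> c v; rewrite !mxE; apply: spnM.
- by move=> q v; rewrite !mxE; apply: spn_cz.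
Qed.

Lemma nzd_row T f : nzd T f -> forall v : 'rV[S]_1, row_of (spn T) (f *: v) -> row_of (spn T) v.
Proof. by move=> nf v; rewrite /row_of mxE; apply: nf. Qed.

Lemma zadd_row T f v : zadd (row_of (spn T)) f v <-> row_of (spn (addg T f)) v.
Proof.
rewrite /row_of spn_addg; split=> [[w]|[c Tc]].
  by rewrite !mxE mulrC; exists (w 0 0).
by exists (const_mx c); rewrite /row_of !mxE mulrC.
Qed.

Lemma RU_add T f (d rho : int) : homogeneous T -> 1 <= d -> cz d f = f -> nzd T f ->
  RU (spn T) rho -> RU (spn (addg T f)) (rho + d - 1).
Proof.
move=> hT d1 fd nf R; apply: RQ_ext (zadd_row T f) _.
exact: RQ_zadd (gsub_spn hT) d1 fd (nzd_row nf) R.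
Qed.

Lemma NU_add T f (d rho : int) g h i j : homogeneous T -> cz (d - 1) g = g -> cz (d - 1) h = h ->
  f = 'X_i * g + 'X_j * h -> nzd T f -> NU (spn T) rho -> NU (spn (addg T f)) (rho + d - 1).
Proof.
move=> hT gd hd fE nf N; apply: NQ_ext (zadd_row T f) _.
exact: NQ_zadd (gsub_spn hT) gd hd fE (nzd_row nf) N.
Qed.

Lemma RU_of_var T i rho : homogeneous T -> nzd T 'X_i ->
  RU (spn (addg T 'X_i)) rho -> RU (spn T) rho.
Proof.
move=> hT nf R; apply: RQ_of_zadd_var (gsub_spn hT) (nzd_row nf) _.
by apply: RQ_ext R => v; split=> /zadd_row.
Qed.

Lemma RU_of_colon T f (I : S -> Prop) rho : homogeneous T -> cz 1 f = f ->
  (forall p, I p <-> spn T (f * p)) -> RU I (rho - 1) -> RU (spn (addg T f)) rho -> RU (spn T) rho.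
Proof.
move=> hT fd IE RI R; apply: RQ_of_colon (gsub_spn hT) fd _ _.
  by apply: RQ_ext RI => v; rewrite /row_of mxE; apply: IE.
by apply: RQ_ext R => v; split=> /zadd_row.
Qed.

Definition unig T1 T2 g := T1 g \/ T2 g.

Lemma spn_unig T1 T2 p : spn (unig T1 T2) p <-> exists2 w, spn T2 w & spn T1 (p - w).
Proof.
split=> [|[w T2w T1p]].
  elim=> [|c g q Tg _ [w T2w T1w]]; first by exists 0; rewrite ?subr0; exact: spn0.
  case: Tg => Tg; first by exists w => //; rewrite -addrA; apply: spn_cons.
  by exists (c * g + w); [apply: spn_cons | rewrite opprD addrACA subrr add0r].
rewrite -[p](subrK w); apply: spnD.
  by apply: spn_mono T1p => g ?; apply: spn_gen; left.
by apply: spn_mono T2w => g ?; apply: spn_gen; right.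
Qed.

Lemma zsum_row T1 T2 v :
  row_of (spn (unig T1 T2)) v <-> zsum (row_of (spn T1)) (row_of (spn T2)) v.
Proof.
rewrite /row_of spn_unig; split=> [[w T2w T1w]|[w T2w T1w]].
  by exists (const_mx w); rewrite /row_of !mxE.
by exists (w 0 0) => //; move: T1w; rewrite /row_of !mxE.
Qed.

Lemma RU_cap T1 T2 rho sigma : homogeneous T1 -> homogeneous T2 -> sigma < rho ->
  RU (spn (unig T1 T2)) sigma -> RU (spn T1) rho -> RU (spn T2) rho ->
  RU (fun p => spn T1 p /\ spn T2 p) rho.
Proof.
move=> h1 h2 sr R12; apply: (RQ_cap (gsub_spn h1) (gsub_spn h2) sr).
by apply: RQ_ext R12 => v; apply: zsum_row.
Qed.

Lemma NU_cap T1 T2 rho sigma : homogeneous T1 -> homogeneous T2 -> sigma < rho ->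
  RU (spn (unig T1 T2)) sigma -> NU (spn T2) rho ->
  NU (fun p => spn T1 p /\ spn T2 p) rho.
Proof.
move=> h1 h2 sr R12; apply: (NQ_cap (gsub_spn h1) (gsub_spn h2) sr).
by apply: RQ_ext R12 => v; apply: zsum_row.
Qed.

Definition varg (A : pred 'I_m) g := exists2 i, A i & g = 'X_i.

Lemma homogeneous_varg A : homogeneous (varg A).
Proof. by move=> g [i _ ->]; exists 1; rewrite cz_var. Qed.

Lemma spn_allvar p : spn (varg predT) (p - cz 0 p).
Proof.
elim/mono_ind: p => [|c u p IH]; first by rewrite linear0 subr0; exact: spn0.
rewrite linearD linearZ /= opprD addrACA -scalerBr; apply: spnD => //.
rewrite -mul_mpolyC; apply: spnM; rewrite czX eqz_nat mdeg_eq0.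
case: eqP => [_|/eqP u0]; first by rewrite subrr; exact: spn0.
have [i ui] : exists i, u i != 0%N.
  apply/existsP; apply: contraR u0; rewrite negb_exists => /forallP h.
  by apply/eqP/mnmP=> i; rewrite mnm0E; have := h i; rewrite negbK => /eqP.
rewrite subr0 -(mnm_subK ui) mpolyXD mulrC; apply/spnM/spn_gen.
by exists i.
Qed.

Lemma RU_allvar : RU (spn (varg predT)) 0.
Proof.
move=> q z q0 hz _; exists 0; first by apply: kall0; case: (@addsub_hom K m 1 a0 (q - 1)).
rewrite linear0 subr0; apply: kall_imp hz => v hv; rewrite /row_of.
have := spn_allvar (v 0 0); have /rowP/(_ 0) := hv; rewrite mxE subr0 => <-.
by rewrite cz_id ifN ?subr0 // lt_eqF.
Qed.

(** Starts from the residue field and removes variables from the generators one at a time; the empty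
    set of variables gives S itself. *)
Lemma RU_vars (A : pred 'I_m) : RU (spn (varg A)) 0.
Proof.
have RN (s : seq 'I_m) : uniq s -> RU (spn (varg (fun i => i \notin s))) 0.
  elim: s => [|i s IH] /=.
    by move=> _; apply: RU_ext RU_allvar => p; split; apply: spn_mono => g [j _ ->]; apply: spn_gen; exists j.
  case/andP=> nis /IH R; apply: (@RU_of_var _ i) => //; first exact: homogeneous_varg.
    apply: free_nzd => g [j]; rewrite inE negb_or => /andP[ji _] ->.
    by rewrite Ev_var // eq_sym.
  apply: RU_ext R => p; split; apply: spn_mono => g.
    case=> j js ->; apply: spn_gen; have [->|ji] := eqVneq j i; [by right | left].
    by exists j => //; rewrite inE negb_or ji.
  case=> [[j]|->]; last by apply: spn_gen; exists i.
  by rewrite inE negb_or => /andP[_ js] ->; apply: spn_gen; exists j.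
apply: RU_ext (RN (enum (predC A)) (enum_uniq _)) => p.
by split; apply: spn_mono => g [j jA ->]; apply: spn_gen; exists j => //;
  move: jA; rewrite mem_enum !inE ?negbK.
Qed.

Lemma NU0 : NU (spn (fun _ => False)) 0.
Proof.
pose v : 'rV[S]_1 := const_mx 1.
have dk : kd (kin (enum 'I_m) v) = 0.
  by elim: (enum 'I_m) => [|i s IH] //=; rewrite IH scaler0 addr0 linear0 oppr0.
exists (kin _ v); split.
- apply: kall_in; first by case: (@addsub_hom K m 1 a0 0).
  by apply/rowP=> k; rewrite !mxE subr0 cz0E mcoeff1 eqxx.
- by rewrite dk; apply: kall0; rewrite /row_of mxE; exact: spn0.
- move=> w /kall_bot; rewrite kbot_sub /row_of !mxE.
  have -> : kbot (kin (enum 'I_m) v) = v by elim: (enum 'I_m).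
  move=> h; have {h} : v 0 0 - kbot (kd w) 0 0 = 0 by case: h.
  move/(congr1 (@cz K m 0)); rewrite linearB linear0 /= kbot_kd_const subr0 mxE.
  by rewrite cz0E mcoeff1 eqxx => /eqP; rewrite oner_eq0.
Qed.

End Ideals.

(** * Ideals of 2-minors *)

Lemma ltn_sum_strict (I : finType) (f g : I -> nat) i0 :
  (forall i, (f i <= g i)%N) -> (f i0 < g i0)%N -> (\sum_i f i < \sum_i g i)%N.
Proof.
move=> fg fg0; rewrite (bigD1 i0) //= [X in (_ < X)%N](bigD1 i0) //=.
by rewrite -addSn leq_add // leq_sum.
Qed.

Section Determinantal.
Variables (K : fieldType) (n : nat).
Local Notation S := {mpoly K[n + n]}.
Local Notation xi i := (lshift n i : 'I_(n + n)).
Local Notation yi i := (rshift n i : 'I_(n + n)).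
Local Notation x i := (xv K i).
Local Notation y i := (yv K i).
Implicit Types (i j : 'I_n) (p q : S) (u v w : 'X_{1..n + n}).

Definition bin i j : S := x i * y j - x j * y i.
Definition minors k (g : S) := exists i j, [/\ (i < j)%N, (j < k)%N & g = bin i j].

Lemma bin_anti i j : bin i j = - bin j i.
Proof. by rewrite /bin opprB. Qed.

Lemma cz_bin i j : cz 2 (bin i j) = bin i j.
Proof.
have e (a b : 'I_(n + n)) : cz 2 ('X_a * 'X_b : S) = 'X_a * 'X_b.
  by rewrite (@cz_mul K (n + n) 1 1) cz_var.
by rewrite /bin linearB /= /xv /yv !e.
Qed.

Lemma homogeneous_minors k : homogeneous (minors k).
Proof. by move=> g [i [j [_ _ ->]]]; exists 2; rewrite cz_bin. Qed.

Lemma spn_bin k i j : (i < k)%N -> (j < k)%N -> spn (minors k) (bin i j).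
Proof.
move=> ik jk; have [ij|ji|/val_inj ->] := ltngtP i j.
- by apply: spn_gen; exists i, j.
- by rewrite bin_anti -mulN1r; apply/spnM/spn_gen; exists j, i.
- by rewrite /bin subrr; exact: spn0.
Qed.

(* Two monomials have the same image under the toric map x_i -> s t_i, y_i -> u t_i (i < k),
   whose kernel is the ideal of 2-minors. *)
Definition toric k u v : bool :=
  [forall i : 'I_n, if (i < k)%N then (u (xi i) + u (yi i) == v (xi i) + v (yi i))%N
     else (u (xi i) == v (xi i)) && (u (yi i) == v (yi i))]
  && (\sum_i u (xi i) == \sum_i v (xi i))%N.

Lemma toricP k u v : reflect
  ((forall i, if (i < k)%N then (u (xi i) + u (yi i) = v (xi i) + v (yi i))%N
     else u (xi i) = v (xi i) /\ u (yi i) = v (yi i)) /\ (\sum_i u (xi i) = \sum_i v (xi i))%N)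
  (toric k u v).
Proof.
apply: (iffP andP) => [[/forallP h /eqP s]|[h s]]; split=> //; last by apply/eqP.
  by move=> i; have := h i; case: ifP => _; [move/eqP | case/andP=> /eqP ? /eqP].
by apply/forallP=> i; have := h i; case: ifP => _; [move=> -> | case=> -> ->]; rewrite ?eqxx.
Qed.

Lemma toric_refl k u : toric k u u.
Proof. by apply/toricP; split=> // i; case: ifP. Qed.

Lemma toric_eq k u v w : toric k u v -> toric k u w = toric k v w.
Proof.
move=> /toricP[h s]; apply/toricP/toricP=> -[h' s'];
  (split; last by [rewrite -s | rewrite s]) => i; have := h i; have := h' i; case: ifP => _; lia.
Qed.

Lemma toric_sym k u v : toric k u v = toric k v u.
Proof.
by apply/idP/idP => h; [rewrite -(toric_eq u h) | rewrite -(toric_eq v h)]; exact: toric_refl.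
Qed.

Lemma toric_add2r k w u v : toric k (u + w) (v + w) = toric k u v.
Proof.
have sE t : (\sum_i (t + w)%MM (xi i) = \sum_i t (xi i) + \sum_i w (xi i))%N.
  by rewrite -big_split; apply: eq_bigr => i _; rewrite mnmDE.
apply/toricP/toricP; rewrite !sE => -[h s]; split; try lia; move=> i; have := h i;
  rewrite !mnmDE; case: ifP => _; lia.
Qed.

(** The sum of the coefficients of a polynomial over the toric class of u. The ideal of minors turns
    out to be the common kernel of these forms. *)
Definition tclass k u := linext (fun v => if toric k v u then 1 else 0 : S).
HB.instance Definition _ k u := GRing.Linear.on (tclass k u).

Lemma tclassX k u v : tclass k u 'X_[v] = if toric k v u then 1 else 0.
Proof. exact: linextX. Qed.

Lemma toric_swap k w i j : (i < k)%N -> (j < k)%N ->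
  toric k (U_(xi i) + U_(yi j) + w) (U_(xi j) + U_(yi i) + w).
Proof.
move=> ik jk; rewrite toric_add2r; apply/toricP; split; last first.
  have sE (a b : 'I_n) : (\sum_l (U_(xi a) + U_(yi b))%MM (xi l) = 1)%N.
    rewrite (bigD1 a) //= mnmDE !mnm1E eqxx eq_rlshift big1 // => l la.
    by rewrite mnmDE !mnm1E eq_lshift eq_rlshift eq_sym (negPf la).
  by rewrite !sE.
move=> l; rewrite !mnmDE !mnm1E !eq_lshift !eq_rshift !eq_rlshift !eq_lrshift /= !addn0 !add0n.
case: ifP => lk; first by rewrite addnC.
have il : (i == l) = false by apply: contraFF lk => /eqP <-.
have jl : (j == l) = false by apply: contraFF lk => /eqP <-.
by rewrite il jl.
Qed.

Lemma binX i j w : bin i j * 'X_[w] =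
  'X_[U_(xi i) + U_(yi j) + w] - 'X_[U_(xi j) + U_(yi i) + w].
Proof. by rewrite /bin mulrBl /xv /yv !mpolyXD. Qed.

Lemma tclass_minors k u p : spn (minors k) p -> tclass k u p = 0.
Proof.
elim=> [|c g q [i [j [ij jk ->]]] _ IH]; first by rewrite linear0.
rewrite linearD /= IH addr0; elim/mono_ind: c => [|c w p' IHc]; first by rewrite mul0r linear0.
rewrite mulrDl linearD /= IHc addr0 -scalerAl linearZ /= mulrC binX linearB /= !tclassX.
by rewrite (toric_eq _ (toric_swap w (ltn_trans ij jk) jk)) subrr scaler0.
Qed.

(** Induction on the excess of x-exponents of u over v. If x_i is in excess, some x_j is in deficit
    since the totals agree; the column sum at j then forces y_j to divide u, and trading x_i y_j for
    x_j y_i lowers the excess. *)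
Lemma toric_connected k u v : toric k u v -> spn (minors k) ('X_[u] - 'X_[v]).
Proof.
move: {2}(\sum_l (u (xi l) - v (xi l)))%N (leqnn (\sum_l (u (xi l) - v (xi l)))%N) => N.
elim: N u => [|N IH] u leN uv.
  have /toricP[h s] := uv.
  have le l : (u (xi l) <= v (xi l))%N.
    by rewrite -subn_eq0 -leqn0; apply: leq_trans leN; rewrite (bigD1 l) //= leq_addr.
  have eqx l : u (xi l) = v (xi l).
    apply/eqP; rewrite eqn_leq le /= leqNgt; apply/negP=> lt.
    by have := ltn_sum_strict (f := fun l => u (xi l)) (g := fun l => v (xi l)) le lt; rewrite s ltnn.
  have -> : u = v.
    apply/mnmP=> z; case: (split_ordP z) => l ->; first exact: eqx.
    by have := h l; have := eqx l; case: ifP => _ ? => [|[]]; lia.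
  by rewrite subrr; exact: spn0.
have [/existsP[i ui]|] := boolP [exists i : 'I_n, (v (xi i) < u (xi i))%N]; last first.
  rewrite negb_exists => /forallP le; apply: IH => //; apply: leq_trans (leq0n _).
  by rewrite big1 // => l _; apply/eqP; rewrite subn_eq0 leqNgt le.
have /toricP[h s] := uv.
have [j uj] : exists j : 'I_n, (u (xi j) < v (xi j))%N.
  apply/existsP; rewrite -[X in is_true X]negbK negb_exists; apply/negP=> /forallP le.
  have le' l : (v (xi l) <= u (xi l))%N by rewrite leqNgt le.
  by have := ltn_sum_strict (f := fun l => v (xi l)) (g := fun l => u (xi l)) le' ui; rewrite s ltnn.
have ik : (i < k)%N by have := h i; case: ifP => // _ [e _]; move: ui; rewrite e ltnn.
have jk : (j < k)%N by have := h j; case: ifP => // _ [e _]; move: uj; rewrite e ltnn.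
have yj : (0 < u (yi j))%N by have := h j; rewrite jk; lia.
have ij : i != j by apply: contraTneq ui => ->; rewrite -leqNgt ltnW.
pose w := (u - (U_(xi i) + U_(yi j)))%MM.
have uE : u = (U_(xi i) + U_(yi j) + w)%MM.
  apply/mnmP=> z; rewrite mnmDE mnmBE !mnmDE !mnm1E.
  case: eqP => [<-|_]; case: eqP => [e|_]; rewrite ?eq_rlshift; try lia.
    by move/eqP: e; rewrite eq_rlshift.
  by rewrite -e; lia.
pose u' := (U_(xi j) + U_(yi i) + w)%MM.
have uu' : toric k u u' by rewrite {1}uE; apply: toric_swap.
have -> : 'X_[u] - 'X_[v] = bin i j * 'X_[w] + ('X_[u'] - 'X_[v]) :> S.
  by rewrite binX -uE addrA subrK.
apply: spnD; first by rewrite mulrC; apply/spnM/spn_bin.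
apply: IH; last by rewrite -(toric_eq _ uu').
rewrite -ltnS; apply: leq_trans leN.
have ux l : u (xi l) = ((i == l) + w (xi l))%N.
  by rewrite {1}uE !mnmDE !mnm1E eq_lshift eq_rlshift addn0.
have ux' l : u' (xi l) = ((j == l) + w (xi l))%N.
  by rewrite !mnmDE !mnm1E eq_lshift eq_rlshift addn0.
apply: (@ltn_sum_strict _ _ _ i) => [l|]; last first.
  by have := ux i; have := ux' i; rewrite eqxx eq_sym (negPf ij) /=; lia.
have := ux l; have := ux' l; case: (eqVneq j l) => [<-|_] /=; last by lia.
by rewrite (negPf ij) /=; lia.
Qed.

(** A vanishing class sum puts a second monomial of p in the class of u; moving the coefficient of u
    onto it, modulo the minors, shortens the support. *)
Lemma minors_toric k p : (forall u, tclass k u p = 0) -> spn (minors k) p.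
Proof.
move: {2}(size (msupp p)) (leqnn (size (msupp p))) => N.
elim: N p => [|N IH] p leN p0.
  by move: leN; rewrite leqn0 size_eq0 msupp_eq0 => /eqP->; exact: spn0.
have [->|pn0] := eqVneq p 0; first exact: spn0.
have [u up] : exists u, u \in msupp p.
  by move: pn0; rewrite -msupp_eq0; case: (msupp p) => // u s _; exists u; rewrite inE eqxx.
have [v [vp vu vT]] : exists v, [/\ v \in msupp p, v != u & toric k v u].
  apply: NNPP => nv; have := p0 u; rewrite /tclass /linext (bigD1_seq u) ?msupp_uniq //=.
  rewrite toric_refl big_seq_cond big1 ?addr0; last first.
    move=> v /andP[vp vu]; case: ifP => vT; last by rewrite scaler0.
    by case: nv; exists v.
  move=> /eqP; rewrite scaler_eq0 oner_eq0 orbF => /eqP pu.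
  by move: up; rewrite mcoeff_msupp pu eqxx.
pose p' := p - p@_u *: ('X_[u] - 'X_[v]).
have -> : p = p' + p@_u *: ('X_[u] - 'X_[v]) by rewrite subrK.
apply: spnD; last first.
  by rewrite -mul_mpolyC; apply/spnM/toric_connected; rewrite toric_sym.
have p'u : p'@_u = 0.
  by rewrite mcoeffB mcoeffZ mcoeffB !mcoeffX eqxx (negPf vu) subr0 mulr1 subrr.
apply: IH => [|w].
  rewrite -ltnS; apply: leq_trans leN.
  have sub : {subset u :: msupp p' <= msupp p}.
    move=> w; rewrite inE => /orP[/eqP->//|]; rewrite !mcoeff_msupp.
    have [->|wu] := eqVneq w u; first by rewrite p'u eqxx.
    have [->|wv] := eqVneq w v; first by move: vp; rewrite mcoeff_msupp.
    by rewrite mcoeffB mcoeffZ mcoeffB !mcoeffX ![_ == w]eq_sym (negPf wu) (negPf wv) subrr mulr0 subr0.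
  apply: (uniq_leq_size _ sub); rewrite /= msupp_uniq andbT.
  by rewrite mcoeff_msupp p'u eqxx.
rewrite linearB linearZ linearB /= p0 !tclassX -(toric_eq w vT).
by rewrite subrr scaler0 subr0.
Qed.

(** Multiplication by a variable sends distinct toric classes to distinct classes, so each class sum
    of p is a class sum of X_z p. *)
Lemma minors_nzd k (z : 'I_(n + n)) : nzd (minors k) 'X_z.
Proof.
move=> p Zp; apply: minors_toric => u; rewrite -(tclass_minors (U_(z) + u) Zp).
elim/mono_ind: p {Zp} => [|c v p IH]; first by rewrite mulr0 !linear0.
rewrite mulrDr !linearD /= IH -scalerAr !linearZ /= -mpolyXD !tclassX.
by rewrite ![(U_(z) + _)%MM]addmC toric_add2r.
Qed.

Lemma free_minors_x k i : (k <= i)%N -> var_free (xi i) (minors k).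
Proof.
move=> ki g [a [b [ab bk ->]]]; rewrite /bin linearB /= !Ev_mul !Ev_var ?eq_lshift ?eq_lrshift //.
- by apply: contraTneq bk => <-; rewrite -leqNgt.
- by apply: contraTneq (ltn_trans ab bk) => <-; rewrite -leqNgt.
Qed.

Lemma free_minors_y k i : (k <= i)%N -> var_free (yi i) (minors k).
Proof.
move=> ki g [a [b [ab bk ->]]]; rewrite /bin linearB /= !Ev_mul !Ev_var ?eq_rshift ?eq_rlshift //.
- by apply: contraTneq (ltn_trans ab bk) => <-; rewrite -leqNgt.
- by apply: contraTneq bk => <-; rewrite -leqNgt.
Qed.

Lemma RU_add_xy T i (rho : int) : homogeneous T -> var_free (xi i) T -> var_free (yi i) T ->
  RU (spn T) rho -> RU (spn (addg (addg T (x i)) (y i))) rho.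
Proof.
move=> hT fx fy R; rewrite -[rho](addrK 1) -[rho](addrK 1).
have hx := homogeneous_addg hT (cz_var K (xi i)).
apply: RU_add => //; first exact: cz_var.
  by apply: free_nzd; apply: free_addg => //; rewrite Ev_var // eq_rlshift.
by apply: RU_add => //; [exact: cz_var | exact: free_nzd].
Qed.

Lemma NU_add_var (T : S -> Prop) (z : 'I_(n + n)) (rho : int) : homogeneous T -> var_free z T ->
  NU (spn T) rho -> NU (spn (addg T 'X_z)) rho.
Proof.
move=> hT fz N; rewrite -[rho](addrK 1).
apply: (@NU_add _ _ T 'X_z 1 rho 1 0 z z) => //; rewrite ?subrr ?linear0 //.
- by rewrite cz0E mcoeff1 eqxx.
- by rewrite mulr1 mulr0 addr0.
- exact: free_nzd.
Qed.

Lemma NU_add_xy T i (rho : int) : homogeneous T -> var_free (xi i) T -> var_free (yi i) T ->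
  NU (spn T) rho -> NU (spn (addg (addg T (x i)) (y i))) rho.
Proof.
move=> hT fx fy N; apply: NU_add_var.
- exact: homogeneous_addg (cz_var K (xi i)).
- by apply: free_addg => //; rewrite Ev_var // eq_rlshift.
- exact: NU_add_var.
Qed.

(** For the new column z, x_z is a nonzerodivisor and can be added first. Then y_z x_i = [bin i z] +
    y_i x_z shows that the colon by y_z is generated by the variables x_i, hence 0-regular, while
    adding y_z as well kills all minors that involve z and leaves the case of k columns. *)
Lemma RU_minors k : (k <= n)%N -> RU (spn (minors k)) 1.
Proof.
elim: k => [|k IH] kn.
  apply: (@RU_le _ _ _ 0 1) => //.
  apply: RU_ext (@RU_vars K _ (fun _ : 'I_(n + n) => false)) => p.
  by split; apply: spn_mono => g [i] // [j] [].
pose z : 'I_n := Ordinal kn.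
have hM := @homogeneous_minors k.+1; have hMx := homogeneous_addg hM (cz_var K (xi z)).
pose A (t : 'I_(n + n)) := [exists i : 'I_n, (i <= k)%N && (t == xi i)].
have Ax (i : 'I_n) : (i < k.+1)%N -> spn (varg (K := K) A) (x i).
  by move=> ik; apply: spn_gen; exists (xi i) => //; apply/existsP; exists i; rewrite eqxx andbT.
have fy : var_free (yi z) (varg (K := K) A).
  by move=> g [t /existsP[i /andP[_ /eqP->]] ->]; rewrite Ev_var // eq_rlshift.
apply: (@RU_of_var _ _ _ (xi z)) => //; first exact: minors_nzd.
apply: (@RU_of_colon _ _ _ (y z) (spn (varg A))) => //.
- exact: cz_var.
- move=> p; split.
    elim=> [|c g q [t /existsP[i /andP[ik /eqP->]] ->] _ IHq]; first by rewrite mulr0; exact: spn0.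
    rewrite mulrDr; apply: spnD => //.
    rewrite (_ : y z * _ = c * bin i z + c * y i * x z); last by rewrite /bin /xv /yv; ring.
    apply: spnD; apply: spnM; last by apply: spn_gen; right.
    apply: (@spn_mono _ _ (minors k.+1)); last by apply: spn_bin => //; rewrite ltnS.
    by move=> g' ?; apply: spn_gen; left.
  move=> Zp; apply: (free_nzd fy); apply: spn_mono Zp => g [[a [b [ab bk ->]]]|->]; last exact: Ax.
  by rewrite /bin ![x _ * _]mulrC; apply: spnB; apply: spnM; apply: Ax => //; apply: ltn_trans bk.
- by rewrite subrr; apply: RU_vars.
have R := RU_add_xy (@homogeneous_minors k) (@free_minors_x k z (leqnn k))
  (@free_minors_y k z (leqnn k)) (IH (ltnW kn)).
apply: RU_ext R => p; split; apply: spn_mono => g.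
  case=> [[[a [b [ab bk ->]]]|->]|->]; apply: spn_gen; [left; left | by left; right | by right].
  by exists a, b; split=> //; apply: ltnW.
case=> [[[a [b [ab bk ->]]]|->]|->]; [| by apply: spn_gen; left; right | by apply: spn_gen; right].
move: bk; rewrite ltnS leq_eqVlt => /orP[/eqP bk|bk]; last first.
  by apply: spn_gen; left; left; exists a, b.
have -> : b = z by apply/val_inj.
rewrite /bin [x z * _]mulrC; apply: spnB; apply: spnM; apply: spn_gen; first by right.
by left; right.
Qed.

End Determinantal.

(** * Binomial edge ideals of linear forests and of their cones *)

Section PathEdges.
Variables (K : fieldType) (n : nat) (e : nat -> bool).
Local Notation S := {mpoly K[n + n]}.
Local Notation xi i := (lshift n i : 'I_(n + n)).
Local Notation yi i := (rshift n i : 'I_(n + n)).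
Local Notation x i := (xv K i).
Local Notation y i := (yv K i).
Implicit Types (i j z : 'I_n) (p q h : S).

Definition edges k (g : S) := exists i j, [/\ (i < k)%N, e i, j = i.+1 :> nat & g = bin K i j].
Definition edge_count k := (\sum_(0 <= i < k) e i)%N.

Lemma homogeneous_edges k : homogeneous (edges k).
Proof. by move=> g [i [j [_ _ _ ->]]]; exists 2; rewrite cz_bin. Qed.

Lemma free_edges_x k z : (k < z)%N -> var_free (xi z) (edges k).
Proof.
move=> kz g [a [b [ak _ ba ->]]].
rewrite /bin linearB /= !Ev_mul !Ev_var ?eq_lshift ?eq_lrshift // -val_eqE /=; lia.
Qed.

Lemma free_edges_y k z : (k < z)%N -> var_free (yi z) (edges k).
Proof.
move=> kz g [a [b [ak _ ba ->]]].
rewrite /bin linearB /= !Ev_mul !Ev_var ?eq_rshift ?eq_rlshift // -val_eqE /=; lia.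
Qed.

Lemma coef_Dv (z : 'I_(n + n)) p u : (Dv z p)@_u = p@_(u + U_(z)).
Proof.
rewrite [in RHS](EvDv z p) mcoeffD coef_Ev mnmDE mnm1E eqxx addn1 add0r.
by rewrite mulrC addmC mcoeffMX.
Qed.

Lemma Ev_bin i j : i != j -> Ev (xi j) (bin K i j) = x i * y j.
Proof.
move=> ij; rewrite /bin linearB /= !Ev_mul /xv /yv Ev_X mul0r subr0 !Ev_var ?eq_lrshift //.
by rewrite eq_lshift eq_sym.
Qed.

(** At x_j = 0 the binomial becomes x_i y_j, a product of nonzerodivisors, so the part of h without
    x_j lies in the ideal; the rest is divided by x_j, with induction on the degree in x_j. *)
Lemma nzd_bin T i j : var_free (xi j) T -> var_free (yi j) T -> nzd T (x i) -> i != j ->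
  nzd T (bin K i j).
Proof.
move=> fx fy nx ij.
have Eb h : Ev (xi j) (bin K i j * h) = y j * (x i * Ev (xi j) h).
  by rewrite Ev_mul Ev_bin // /xv /yv; ring.
have E0 h : spn T (bin K i j * h) -> spn T (Ev (xi j) h).
  by move=> /(spn_Ev fx); rewrite Eb => /(free_nzd fy)/nx.
suff H N h : (forall u : 'X_{1..n + n}, (N <= u (xi j))%N -> h@_u = 0) -> spn T (bin K i j * h) -> spn T h.
  move=> h; apply: (H (msize h)) => u hu; apply: memN_msupp_eq0.
  apply: contraL hu => /msize_mdeg_lt; rewrite -ltnNge; apply: leq_ltn_trans.
  by rewrite mdegE (bigD1 (xi j)) //= leq_addr.
elim: N h => [|N IH] h hN Th.
  have -> : h = 0 by apply/mpolyP=> u; rewrite mcoeff0 hN.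
  exact: spn0.
rewrite (EvDv (xi j) h); apply: spnD; first exact: E0.
apply/spnM/IH.
  by move=> u Nu; rewrite coef_Dv hN // mnmDE mnm1E eqxx addn1.
apply: (free_nzd fx); rewrite mulrCA.
rewrite (_ : 'X_(xi j) * _ = h - Ev (xi j) h); last by rewrite {2}(EvDv (xi j) h) addrC addKr.
by rewrite mulrBr; apply: spnB => //; apply/spnM/E0.
Qed.

(** Keeps the induction along a path going: an edge leaving j needs x_j to be a nonzerodivisor. If
    x_j p = h f modulo T, where f is the binomial, then setting x_j to 0 puts the part of h without
    x_j in T; hence h can be divided by x_j modulo T. *)
Lemma nzd_x_addg_bin T i j : var_free (xi j) T -> var_free (yi j) T -> nzd T (x i) -> i != j ->
  nzd (addg T (bin K i j)) (x j).
Proof.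
move=> fx fy nx ij p /spn_addg[h Th]; apply/spn_addg; exists (Dv (xi j) h).
have Eh : spn T (Ev (xi j) h).
  have := spnM (-1) (spn_Ev fx Th); rewrite linearB /= Ev_mulX sub0r Ev_mul Ev_bin //.
  by rewrite mulN1r opprK (_ : _ * _ = y j * (x i * Ev (xi j) h)) => [/(free_nzd fy)/nx|]; last by ring.
apply: (free_nzd fx).
rewrite (_ : _ * _ = (x j * p - h * bin K i j) + bin K i j * Ev (xi j) h).
  by apply: spnD => //; apply: spnM.
by rewrite {2}(EvDv (xi j) h) /xv; ring.
Qed.

Lemma edges_reg k : (k < n)%N ->
  [/\ RU (spn (edges k)) (edge_count k), NU (spn (edges k)) (edge_count k)
    & forall z, z = k :> nat -> nzd (edges k) (x z)].
Proof.
elim: k => [|k IH] kn.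
  have E0 p : spn (fun _ => False) p <-> spn (edges 0) p.
    by split; apply: spn_mono => g // [a [b []]].
  rewrite /edge_count big_geq //; split.
  - apply: RU_ext (@RU_vars K _ (fun _ : 'I_(n + n) => false)) => p.
    by split; apply: spn_mono => g [a] // [b] [].
  - exact: NU_ext E0 (NU0 _ _).
  - by move=> z z0; apply: free_nzd => g [a [b []]].
have [R N nx] := IH (ltnW kn).
pose i := Ordinal (ltnW kn); pose j := Ordinal kn.
have fx : var_free (xi j) (edges k) by apply: free_edges_x.
have fy : var_free (yi j) (edges k) by apply: free_edges_y.
rewrite /edge_count big_nat_recr //= -/(edge_count k).
have [ek|ek] := boolP (e k); last first.
  have EE p : spn (edges k) p <-> spn (edges k.+1) p.
    split; apply: spn_mono => g [a [b [ak ea ba ->]]]; apply: spn_gen; exists a, b; split=> //.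
      exact: ltnW.
    by rewrite ltn_neqAle -ltnS ak andbT; apply: contraNneq ek => <-.
  rewrite addn0; split; [exact: RU_ext R | exact: NU_ext N |].
  move=> z zk p /EE Zp; apply/EE; apply: free_nzd Zp.
  have -> : z = j by apply/val_inj.
  exact: fx.
have ij : i != j by rewrite -val_eqE /= neq_ltn ltnSn.
have nxi : nzd (edges k) (x i) by apply: nx.
have EE p : spn (addg (edges k) (bin K i j)) p <-> spn (edges k.+1) p.
  split; apply: spn_mono => g.
    case=> [[a [b [ak ea ba ->]]]|->]; apply: spn_gen; last by exists i, j.
    by exists a, b; split=> //; apply: ltnW.
  case=> a [b [ak ea ba ->]]; apply: spn_gen; have [ak'|ka] := ltnP a k.
    by left; exists a, b.
  have ak'' : val a = k by apply/eqP; rewrite eqn_leq ka -ltnS ak.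
  by right; congr (bin _ _ _); apply/val_inj; rewrite //= ba ak''.
have hE := @homogeneous_edges k.
have nb := nzd_bin fx fy nxi ij.
(* A regular quadric raises the regularity by 2 - 1. *)
rewrite (_ : (_ + true)%:Z = (edge_count k)%:Z + 2 - 1); last by lia.
split.
- by apply: RU_ext EE _; apply: RU_add => //; apply: cz_bin.
- apply: NU_ext EE _; apply: (@NU_add _ _ _ _ 2 _ (y j) (- y i) (xi i) (xi j)) => //.
  + exact: cz_var.
  + by rewrite linearN /= cz_var.
  + by rewrite /bin mulrN.
- move=> z zk p /EE Zp; apply/EE; have zj : z = j by apply/val_inj.
  by move: Zp; rewrite zj; apply: nzd_x_addg_bin.
Qed.

End PathEdges.

(** * The ideal of the cone as an intersection *)

Section ConeIdeal.
Variables (K : fieldType) (N : nat) (e : nat -> bool).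
Hypothesis eN : forall i, e i -> (i.+1 < N)%N.
Local Notation S := {mpoly K[N.+1 + N.+1]}.
Local Notation xi i := (lshift N.+1 i : 'I_(N.+1 + N.+1)).
Local Notation yi i := (rshift N.+1 i : 'I_(N.+1 + N.+1)).
Local Notation x i := (xv K i).
Local Notation y i := (yv K i).
Local Notation apex := (@ord_max N).
Implicit Types (i j : 'I_N.+1) (p q h : S).

(* The cone with vertex N over the linear forest on 0, ..., N - 1 whose edges are
   the pairs {i, i + 1} with [e i]. *)
Definition cone : rel 'I_N.+1 := fun i j =>
  (i != j) && [|| i == apex, j == apex, e i && (val j == i.+1) | e j && (val i == j.+1)].

Definition cone_gens (g : S) := exists i j, [/\ (i < j)%N, cone i j & g = bin K i j].
Definition apex_gens : S -> Prop := addg (addg (edges e N.-1) (x apex)) (y apex).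

Lemma cone_gensE p : in_ideal (binomial_edge_gens K cone) p <-> spn cone_gens p.
Proof.
rewrite in_ideal_spn; split; apply: spn_mono => g.
  case/mapP=> -[i j]; rewrite mem_enum inE /= => /andP[cij ij] ->.
  by apply: spn_gen; exists i, j.
case=> i [j [ij cij ->]]; apply: spn_gen; apply/mapP; exists (i, j) => //.
by rewrite mem_enum inE /= cij.
Qed.

Lemma lt_apex i : (i < N)%N -> i != apex.
Proof. by move=> iN; rewrite -val_eqE /= neq_ltn iN. Qed.

Lemma cone_apex i : (i < N)%N -> spn cone_gens (bin K i apex).
Proof.
move=> iN; apply: spn_gen; exists i, apex; split=> //.
by rewrite /cone lt_apex // eqxx orbT.
Qed.

(** Expansion of the zero determinant with rows x, x, y on the columns i, j and the apex. *)
Lemma apex_x_minors g : minors N g -> spn cone_gens (x apex * g).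
Proof.
case=> i [j [ij jN ->]]; have iN := ltn_trans ij jN.
rewrite (_ : _ * _ = x j * bin K i apex - x i * bin K j apex); last by rewrite /bin; ring.
by apply: spnB; apply/spnM/cone_apex.
Qed.

Lemma apex_y_minors g : minors N g -> spn cone_gens (y apex * g).
Proof.
case=> i [j [ij jN ->]]; have iN := ltn_trans ij jN.
rewrite (_ : _ * _ = y j * bin K i apex - y i * bin K j apex); last by rewrite /bin; ring.
by apply: spnB; apply/spnM/cone_apex.
Qed.

Local Notation kill p := (Ev (xi apex) (Ev (yi apex) p)).

(** The minors avoid the apex variables, so only their coefficients change, by multiples of x and y
    at the apex. *)
Lemma kill_apex p : spn (minors N) p -> spn cone_gens (p - kill p).
Proof.
elim=> [|c g q Mg _ IH]; first by rewrite linear0 /= linear0 subr0; exact: spn0.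
have fx := @free_minors_x K N.+1 N apex (leqnn N).
have fy := @free_minors_y K N.+1 N apex (leqnn N).
rewrite (linearD (Ev (yi apex))) /= (linearD (Ev (xi apex))) /= opprD addrACA; apply: spnD => //.
rewrite !Ev_mul (fy _ Mg) (fx _ Mg) -mulrBl.
have -> : c - kill c = Dv (yi apex) c * y apex + Dv (xi apex) (Ev (yi apex) c) * x apex.
  have cy := EvDv (yi apex) c; have cx := EvDv (xi apex) (Ev (yi apex) c).
  rewrite {1}cy {1}cx /xv /yv; ring.
rewrite mulrDl -!mulrA; apply: spnD; apply: spnM; [exact: apex_y_minors | exact: apex_x_minors].
Qed.

Lemma cone_ideal p :
  spn cone_gens p <-> spn (minors N.+1) p /\ spn apex_gens p.
Proof.
split=> [Cp|[Mp Ap]].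
  split; apply: spn_mono Cp => g [i [j [ij cij ->]]].
    by apply: spn_bin.
  have ia : i != apex by apply: contraTneq ij => ->; rewrite -leqNgt -ltnS.
  have [ja|ja] := eqVneq j apex.
    rewrite ja /bin [x apex * _]mulrC; apply: spnB; apply: spnM; apply: spn_gen; first by right.
    by left; right.
  move: cij; rewrite /cone (negPf ia) (negPf ja) /=
    => /andP[_ /orP[/andP[ei /eqP ji]|/andP[_ /eqP ji]]]; last by lia.
  apply: spn_gen; left; left; exists i, j; split=> //.
  by have := eN ei; lia.
have [d /spn_addg[c Ec]] := (spn_addg _ _ _).1 Ap.
set h0 := _ - _ in Ec; pose h := c * x apex + d * y apex.
have -> : p = h0 + h by rewrite /h0 /h; ring.
have h0C : spn cone_gens h0.
  apply: spn_mono Ec => g [a [b [ak ea ba ->]]]; apply: spn_gen; exists a, b; split=> //.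
    by rewrite ba.
  apply/andP; split; first by rewrite -val_eqE /= ba neq_ltn ltnSn.
  by rewrite ea /= ba eqxx !orbT.
have h0M : spn (minors N.+1) h0.
  by apply: spn_mono Ec => g [a [b [ak ea ba ->]]]; apply: spn_bin.
apply: spnD => //.
have hM : spn (minors N.+1) h.
  by rewrite (_ : h = p - h0); [apply: spnB | rewrite /h0 /h; ring].
(* Here h lies in the ideal of all minors and in the ideal of the two apex variables. Splitting off
   the minors that use the apex, which are edges of the cone and die at zero apex variables, leaves
   a combination of minors off the apex that dies there too, so [kill_apex] applies. *)
have [s [sC sk Mq]] : exists s, [/\ spn cone_gens s, kill s = 0 & spn (minors N) (h - s)].
  elim: hM => [|k g q [i [j [ij jN ->]]] _ [s [sC sk Mq]]].
    by exists 0; split; [exact: spn0 | rewrite linear0 /= linear0 | rewrite subr0; exact: spn0].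
  have [jN'|Nj] := ltnP j N.
    by exists s; split=> //; rewrite -addrA; apply: spnD => //; apply/spnM/spn_gen; exists i, j.
  have ja : j = apex by apply/val_inj/eqP; rewrite /= eqn_leq Nj -ltnS jN.
  have iN : (i < N)%N by rewrite ja in ij.
  exists (k * bin K i j + s); split.
  - by apply: spnD => //; rewrite ja; apply/spnM/cone_apex.
  - rewrite (linearD (Ev (yi apex))) /= (linearD (Ev (xi apex))) /= sk addr0 ja !Ev_mul.
    rewrite /bin linearB /= !Ev_mul /xv /yv Ev_X mulr0 sub0r linearN /= Ev_mul.
    by rewrite (@Ev_var _ _ (yi apex) (xi apex)) ?eq_rlshift // Ev_X mul0r oppr0 mulr0.
  - by rewrite opprD addrACA subrr add0r.
have kh : kill h = 0.
  rewrite /h (linearD (Ev (yi apex))) /= (linearD (Ev (xi apex))) /= !Ev_mul.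
  rewrite /xv /yv (@Ev_var _ _ (yi apex) (xi apex)) ?eq_rlshift // !Ev_X.
  by rewrite linear0 !mulr0 addr0.
rewrite -[h](subrK s); apply: spnD => //.
by have := kill_apex Mq; rewrite (linearB (Ev (yi apex))) /= (linearB (Ev (xi apex))) /= kh sk subrr subr0.
Qed.

Lemma homogeneous_apex_gens : homogeneous apex_gens.
Proof.
apply: homogeneous_addg (cz_var _ _); apply: homogeneous_addg (cz_var _ _).
exact: homogeneous_edges.
Qed.

Lemma regularity_cone (r := edge_count e N.-1) : (2 <= r)%N -> (0 < N)%N ->
  regularity_quot (binomial_edge_gens K cone) r.
Proof.
move=> r2 N0.
have kN : (N.-1 < N.+1)%N by lia.
have [R H _] := edges_reg K e kN.
have fx : var_free (xi apex) (edges (K := K) e N.-1) by apply: free_edges_x => /=; lia.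
have fy : var_free (yi apex) (edges (K := K) e N.-1) by apply: free_edges_y => /=; lia.
have hE := @homogeneous_edges K N.+1 e N.-1.
have R2 : RU (spn apex_gens) r by apply: RU_add_xy.
have H2 : NU (spn apex_gens) r by apply: NU_add_xy.
have hM := @homogeneous_minors K N.+1 N.+1.
(* The edge binomials are themselves minors, so the sum is generated by the two apex variables and
   the minors off the apex. *)
have RP : RU (spn (unig (minors N.+1) apex_gens)) 1.
  have RM : RU (spn (addg (addg (minors N) (x apex)) (y apex))) 1.
    apply: RU_add_xy; [exact: homogeneous_minors | exact: free_minors_x | exact: free_minors_y |].
    by apply: RU_minors; lia.
  apply: RU_ext RM => p; split; apply: spn_mono => g.
    case=> [[[i [j [ij jN ->]]]|->]|->]; apply: spn_gen; [left | by right; left; right | by right; right].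
    by exists i, j; split=> //; apply: ltnW.
  case=> [[i [j [ij jN ->]]]|[[[i [j [iN ei ji ->]]]|->]|->]]; last by apply: spn_gen; right.
  - have [jN'|Nj] := ltnP j N; first by apply: spn_gen; left; left; exists i, j.
    have -> : j = apex by apply/val_inj/eqP; rewrite /= eqn_leq Nj -ltnS jN.
    rewrite /bin [x apex * _]mulrC; apply: spnB; apply: spnM; apply: spn_gen; first by right.
    by left; right.
  - have := eN ei => iN'; apply: spn_gen; left; left; exists i, j; split=> //; lia.
  - by apply: spn_gen; left; right.
pose J p := spn (minors N.+1) p /\ spn apex_gens p.
have RJ : RU J r.
  apply: (@RU_cap _ _ _ _ r 1) => //; first exact: homogeneous_apex_gens.
  by apply: (@RU_le _ _ _ 1); [lia | apply: RU_minors].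
have HJ : NU J r by apply: (@NU_cap _ _ _ _ r 1) => //; exact: homogeneous_apex_gens.
apply: (@regularity_quotI _ _ _ r (row_of J)) => //.
- by move=> v; rewrite /row_of /J cone_gensE cone_ideal.
- by lia.
- have [[a0 aB] aM aC] := gsub_spn hM; have [[b0 bB] bM bC] := gsub_spn homogeneous_apex_gens.
  split; first split.
  + by split; [apply: a0 | apply: b0].
  + by move=> u v [? ?] [? ?]; split; [apply: aB | apply: bB].
  + by move=> c v [? ?]; split; [apply: aM | apply: bM].
  + by move=> q v [? ?]; split; [apply: aC | apply: bC].
- move=> v [Mv _] k; rewrite (ord1 k).
  elim: Mv => [|c g q [i [j [_ _ ->]]] _ IH]; first by rewrite linear0.
  by rewrite linearD /= IH addr0 mulrC (cz_mul (-2) c (cz_bin K i j)) cz_neg ?mulr0.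
Qed.

End ConeIdeal.

(** * The graph *)

Section ConeGraph.
Variables (l r c : nat).
Hypotheses (l2 : (2 <= l)%N) (lr : (l <= r)%N) (rc : (r <= c)%N).

(* A path on 0, ..., l, then r - l disjoint edges, then c - r isolated vertices. *)
Definition forest_order := (l + 2 * (r - l) + (c - r)).+1.
(** The disjoint edges are {l+1, l+2}, {l+3, l+4}, and so on: the parity test selects their lower
    ends. *)
Definition forest_edge (i : nat) : bool :=
  (i < l)%N || [&& (l < i)%N, (i < l + 2 * (r - l))%N & odd (i - l)].
Local Notation N := forest_order.
Local Notation e := forest_edge.
Local Notation G := (@cone N e).
Local Notation apex := (@ord_max N).

Lemma forest_edge_lt i : e i -> (i.+1 < N)%N.
Proof. by rewrite /e /N => /orP[|/and3P[]]; lia. Qed.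

Lemma forest_edge_count : edge_count e N.-1 = r.
Proof.
have H k : edge_count e k = (minn k l + (minn (k - l) (2 * (r - l)))./2)%N.
  elim: k => [|k IH]; first by rewrite /edge_count big_geq //; lia.
  by rewrite /edge_count big_nat_recr //= -/(edge_count e k) IH /e; lia.
by rewrite H /N; lia.
Qed.

Lemma coneE (i j : 'I_N.+1) : G i j = (i != j :> nat) &&
  [|| i == N :> nat, j == N :> nat, e i && (j == i.+1 :> nat) | e j && (i == j.+1 :> nat)].
Proof. by []. Qed.

Lemma cone_simple : simple_graph G.
Proof.
split=> [i j|i]; last by rewrite coneE eqxx.
by rewrite !coneE eq_sym orbCA [X in _ && (_ || (_ || X))]orbC.
Qed.

Lemma cone_connected : connected_graph G.
Proof.
split=> // i j.
have to_apex k : connect G k apex.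
  have [->|ka] := eqVneq k apex; first exact: connect0.
  by apply: connect1; rewrite /cone ka eqxx orbT.
have sym : connect_sym G by apply: symmetric_from_pre => ? ?; rewrite (sym_connect_sym (proj1 cone_simple)).
by apply: connect_trans (to_apex i) _; rewrite sym.
Qed.

Lemma cone_longest_path : longest_induced_path_length G l.
Proof.
split.
  pose s := [seq inord i : 'I_N.+1 | i <- iota 0 l.+1].
  have sE x0 i : (i < l.+1)%N -> nth x0 s i = inord i.
    by move=> il; rewrite (nth_map 0%N) ?size_iota // nth_iota.
  have vE i : (i < l.+1)%N -> nat_of_ord (inord i : 'I_N.+1) = i.
    by move=> il; rewrite inordK //; rewrite /N; lia.
  have ss : size s = l.+1 by rewrite size_map size_iota.
  exists s; split=> //; split; first by rewrite ss.
  split.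
    rewrite map_inj_in_uniq ?iota_uniq // => i j; rewrite !mem_iota add0n => /= il jl.
    by move/(congr1 (@nat_of_ord _)); rewrite !vE.
  move=> x0 i j; rewrite ss => il jl; rewrite !sE // coneE !vE // /e /N; lia.
move=> s [s0 [us Gs]]; rewrite leqNgt; apply/negP=> ls.
have x0 : 'I_N.+1 := ord0.
have [as_|nas] := boolP (apex \in s).
  pose k := index apex s; have ks : (k < size s)%N by rewrite index_mem.
  (* The apex is adjacent to every other vertex of the path, but no position among the first four or
     later is next to all the others of these four; there are four since l >= 2. *)
  have adj i : (i < 4)%N -> i != k -> (k.+1 == i) || (i.+1 == k).
    move=> i4 ik; have is_ : (i < size s)%N by lia.
    rewrite -(Gs x0) // nth_index // /cone eqxx /= andbT.
    by apply: contra ik => /eqP h; rewrite -(nth_uniq x0 is_ ks us) nth_index // h.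
  have := adj 0%N isT; have := adj 1%N isT; have := adj 2%N isT; have := adj 3%N isT.
  lia.
(* A label constant along edges of H: 0 on the long path, and blocks of two consecutive vertices
   beyond it. Isolated vertices are also grouped in pairs, which still bounds a path there by two
   vertices. *)
pose lab v := if (v <= l)%N then 0%N else ((v - l).-1)./2.+1.
have lt_N i : (i < size s)%N -> (nth x0 s i < N)%N.
  move=> is_; have := ltn_ord (nth x0 s i); rewrite ltnS leq_eqVlt => /orP[/eqP iN|//].
  by case/negP: nas; rewrite (_ : apex = nth x0 s i) ?mem_nth //; apply/val_inj.
have labE i : (i < size s)%N -> lab (nth x0 s i) = lab (nth x0 s 0).
  elim: i => [//|i IH] is_; rewrite -IH; last exact: ltnW.
  have := Gs x0 i i.+1 (ltnW is_) is_; rewrite eqxx coneE.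
  have := lt_N i (ltnW is_); have := lt_N _ is_; rewrite /lab /e;
    do ![case: ifP]; lia.
have le_size (t : seq nat) : {subset map (@nat_of_ord _) s <= t} -> (size s <= size t)%N.
  move=> st; rewrite -(size_map (@nat_of_ord _)); apply: uniq_leq_size st.
  by rewrite map_inj_uniq //; apply: ord_inj.
have [l0|l0] := leqP (nth x0 s 0) l.
  suff /le_size : {subset map (@nat_of_ord _) s <= iota 0 l.+1} by rewrite size_iota leqNgt ls.
  move=> v /mapP[w /(nthP x0)[i is_ <-] ->]; rewrite mem_iota.
  by have := labE i is_; rewrite /lab l0; case: ifP.
set v0 := nat_of_ord (nth x0 s 0) in l0.
pose w0 := (l + 1 + 2 * ((v0 - l).-1)./2)%N.
have : (size s <= size [:: w0; w0.+1])%N.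
  apply: le_size => v /mapP[w /(nthP x0)[i is_ <-] ->]; rewrite !inE.
  by have := labE i is_; rewrite /lab -/v0 /w0 [in RHS]leqNgt l0 /=; case: ifP; lia.
by rewrite /=; lia.
Qed.

(* [start t] is the smallest vertex of the t-th maximal clique; [cover_index i] is the index
   of a maximal clique that contains i, namely {i, i + 1, N} if [e i]. *)
Definition start (t : nat) : nat :=
  if (t < l)%N then t else if (t < r)%N then (l + 1 + 2 * (t - l))%N
  else (l + 1 + 2 * (r - l) + (t - r))%N.
Definition cover_index (i : nat) : nat :=
  if (i < l)%N then i else if i == l then l.-1
  else if (i <= l + 2 * (r - l))%N then (l + (i - l).-1./2)%N
  else (r + (i - l - 1 - 2 * (r - l)))%N.

Definition cone_clique (t : nat) : {set 'I_N.+1} :=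
  [set j : 'I_N.+1 | [|| j == N :> nat, j == start t :> nat | e (start t) && (j == (start t).+1 :> nat)]].

Lemma start_edge t : e (start t) = (t < r)%N.
Proof. by rewrite /e /start; do ![case: ifP]; lia. Qed.

Lemma start_lt t : (t < c)%N -> (start t < N)%N.
Proof. by rewrite /start /N; do ![case: ifP]; lia. Qed.

Lemma cover_indexP i : (i < N)%N -> [/\ (cover_index i < c)%N,
  (i == start (cover_index i)) || (e (start (cover_index i)) && (i == (start (cover_index i)).+1))
  & e i -> start (cover_index i) = i].
Proof.
move=> iN; rewrite start_edge; move: iN; rewrite /N /cover_index => iN; split.
- by do ![case: ifP]; lia.
- by rewrite /start; do ![case: ifP]; lia.
- by rewrite /e /start; do ![case: ifP]; lia.
Qed.

Lemma cone_clique_is_clique t : (t < c)%N -> is_clique G (cone_clique t).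
Proof.
move=> tc; apply/forall_inP=> i; rewrite inE => iT; apply/forall_inP=> j; rewrite inE => jT.
apply/implyP=> ij; rewrite coneE; move: ij; rewrite -val_eqE /= => ij; rewrite ij /=.
case/or3P: iT ij => [/eqP->|/eqP->|/andP[et /eqP->]]; case/or3P: jT => [/eqP->|/eqP->|/andP[et' /eqP->]];
  by rewrite ?eqxx ?et ?et' ?orbT.
Qed.

(** The smallest vertex i of D below the apex decides: other members below the apex are larger
    neighbours of i, so only i + 1 is possible. If there is no such i, D lies in the apex alone and
    any clique will do. *)
Lemma clique_sub (D : {set 'I_N.+1}) : is_clique G D -> exists2 t, (t < c)%N & D \subset cone_clique t.
Proof.
move=> /forall_inP cD.
have [/existsP[i0 /andP[i0D i0N]]|] := boolP [exists i : 'I_N.+1, (i \in D) && (i < N)%N]; last first.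
  rewrite negb_exists => /forallP h; exists 0%N; first by lia.
  apply/subsetP=> i iD; rewrite inE; have := h i; rewrite iD /= -leqNgt => iN.
  by rewrite eqn_leq iN -ltnS ltn_ord.
case: (@arg_minnP _ i0 (fun i : 'I_N.+1 => (i \in D) && (i < N)%N) (fun i => i : nat)).
  by rewrite i0D.
move=> i /andP[iD iN] imin; have [tc it ei] := cover_indexP iN.
exists (cover_index i) => //; apply/subsetP=> j jD; rewrite inE.
have [->|ji] := eqVneq j i; first by case/orP: it => ->; rewrite ?orbT.
have [jN|Nj] := ltnP j N; last by rewrite eqn_leq Nj -ltnS ltn_ord.
have ij : (i <= j)%N by apply: imin; rewrite jD.
have := cD i iD => /forall_inP/(_ j jD)/implyP; rewrite eq_sym ji => /(_ isT).
rewrite coneE => /andP[_]; case: (boolP (e i)) => [ei'|_]; last by lia.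
have := ei ei' => ->; rewrite ei' /=; lia.
Qed.

(** Inclusion instead of equality in the hypothesis gives maximality of these cliques together with
    their distinctness. *)
Lemma cone_clique_inj t t' : (t < c)%N -> (t' < c)%N ->
  cone_clique t \subset cone_clique t' -> t = t'.
Proof.
move=> tc tc' /subsetP sub.
have stN := start_lt tc; have stN' := start_lt tc'.
have h1 : (start t == start t') || (e (start t') && (start t == (start t').+1)).
  have st : (start t < N.+1)%N by apply: ltnW.
  have := sub (Ordinal st); rewrite !inE /= eqxx orbT => /(_ isT).
  by rewrite [_ == N]eqn_leq [(N <= _)%N]leqNgt stN andbF.
have h2 : e (start t) -> ((start t).+1 == start t') || (e (start t') && ((start t).+1 == (start t').+1)).
  move=> et; have st : ((start t).+1 < N.+1)%N by apply: ltnW; apply: forest_edge_lt.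
  have := sub (Ordinal st); rewrite !inE /= eqxx et !orbT => /(_ isT).
  by rewrite [_ == N]eqn_leq [(N <= _)%N]leqNgt (forest_edge_lt et) andbF.
move: h1 h2; rewrite !start_edge /start.
by do ![case: ifP]; lia.
Qed.

Lemma cone_num_max_cliques : num_max_cliques G = c.
Proof.
rewrite /num_max_cliques (_ : [set C | _] = [set cone_clique t | t : 'I_c]).
  rewrite card_imset ?card_ord // => t t' /= tt'; apply/val_inj.
  by apply: (cone_clique_inj (ltn_ord t) (ltn_ord t')); rewrite tt'.
apply/setP=> D; rewrite inE; apply/andP/imsetP => [[cD /forallP mD]|[t _ ->]].
  have [t tc Dt] := clique_sub cD; exists (Ordinal tc) => //=.
  have /implyP := mD (cone_clique t); rewrite cone_clique_is_clique // Dt => /(_ isT)/eqP.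
  by [].
split; first exact: cone_clique_is_clique.
apply/forallP=> E; apply/implyP=> /andP[cE tE].
have [t' tc' Et'] := clique_sub cE.
have tt' : val t = t' by apply: (cone_clique_inj (ltn_ord t) tc' (subset_trans tE Et')).
by rewrite eqEsubset tE tt' Et'.
Qed.

End ConeGraph.

Theorem theorem2p5 (K : fieldType) (l r c : nat) :
  (2 <= l)%N -> (l <= r)%N -> (r <= c)%N ->
  exists (n : nat) (G : rel 'I_n),
    [/\ simple_graph G, connected_graph G,
        longest_induced_path_length G l,
        regularity_quot (binomial_edge_gens K G) r
      & num_max_cliques G = c].
Proof.
move=> l2 lr rc; exists (forest_order l r c).+1, (@cone _ (forest_edge l r)); split.
- exact: cone_simple.
- exact: cone_connected.
- exact: cone_longest_path.
- have rE := forest_edge_count l2 lr rc; rewrite -[X in regularity_quot _ X]rE.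
  apply: regularity_cone => //; first by move=> i; apply: forest_edge_lt.
  by rewrite rE; apply: leq_trans lr.
- exact: cone_num_max_cliques.
Qed.
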